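(* Let $\mathbb{M}\subset\mathrm{Gr}_p(\mathbb{R}^{2p})$ be an affine chart, let $\Omega\subset\mathbb{M}$ be a nonempty $\mathcal{R}$-proper open convex subset of $\mathbb{M}$, and suppose $\mathrm{Aut}(\Omega)$ acts cocompactly on $\Omega$. Then $\mathrm{Aut}(\Omega)$ is non-discrete (as a subgroup of $\mathrm{PGL}_{2p}(\mathbb{R})$).
   Context: $\mathrm{Gr}_p(\mathbb{R}^{2p})$ is the Grassmannian of $p$-dimensional subspaces of $\mathbb{R}^{2p}$, with its natural $\mathrm{PGL}_{2p}(\mathbb{R})$-action, regarded as a closed subset of $\mathbb{P}(\wedge^p\mathbb{R}^{2p})$ via $\mathrm{Span}(v_1,\dots,v_p)\mapsto[v_1\wedge\dots\wedge v_p]$. An affine chart is a set $\mathbb{M}=\{U: U\cap W_0=(0)\}$ for some $p$-dimensional subspace $W_0$. Fixing $U_0\in\mathbb{M}$ one identifies $\mathbb{M}$ with $\mathrm{Hom}(U_0,W_0)$ by $T\mapsto\{u+Tu:u\in U_0\}$, hence (choosing bases) with $M_{p,p}(\mathbb{R})$; different choices change this by $X\mapsto AXB+C$ with $A,B$ invertible, so convexity in $\mathbb{M}$ is well defined. $\mathrm{Aut}(\Omega)=\{\varphi\in\mathrm{PGL}_{2p}(\mathbb{R}):\varphi\Omega=\Omega\}$, and it acts cocompactly if $\mathrm{Aut}(\Omega)\cdot K=\Omega$ for some compact $K\subset\Omega$. Let $\mathcal{L}$ be the set of projective lines of $\mathbb{P}(\wedge^p\mathbb{R}^{2p})$ contained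 in $\mathrm{Gr}_p(\mathbb{R}^{2p})$; an open connected set $\Omega$ is $\mathcal{R}$-proper if $|\ell\setminus(\ell\cap\Omega)|>1$ for all $\ell\in\mathcal{L}$. *)

(* Defs.v *)
From HB Require Import structures.
From mathcomp Require Import all_boot all_order perm all_algebra.
From mathcomp Require Import all_classical all_reals all_analysis.

Set Implicit Arguments.
Unset Strict Implicit.
Unset Printing Implicit Defensive.

Import Order.TTheory GRing.Theory Num.Theory.
Import numFieldNormedType.Exports.

Local Open Scope classical_set_scope.
Local Open Scope quotient_scope.
Local Open Scope ring_scope.

Section Proportional.
Variables (R : fieldType) (V : lmodType R) (A : set V).

Definition proportional (x y : A) : bool :=
  `[< exists2 c : R, c != 0 & set_val y = c *: set_val x >].

Lemma proportional_refl : reflexive proportional.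
Proof. by move=> x; apply/asboolP; exists 1; rewrite ?oner_eq0 ?scale1r. Qed.

Lemma proportional_sym : symmetric proportional.
Proof.
suff H x y : proportional x y -> proportional y x.
  by move=> x y; apply/idP/idP; exact: H.
move=> /asboolP[c c0 e]; apply/asboolP; exists c^-1; first by rewrite invr_eq0.
by rewrite e scalerA mulVf ?scale1r.
Qed.

Lemma proportional_trans : transitive proportional.
Proof.
move=> y x z /asboolP[c c0 exy] /asboolP[d d0 eyz]; apply/asboolP.
by exists (d * c); rewrite ?mulf_neq0 // eyz exy scalerA.
Qed.

Canonical proportional_equiv :=
  EquivRel proportional proportional_refl proportional_sym proportional_trans.

End Proportional.

Definition nonzero (R : realType) (N : nat) : set 'cV[R]_N := [set v | v != 0].
Arguments nonzero : clear implicits.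

(* P(R^N), with the quotient of the subspace topology on R^N \ {0}. *)
Definition projspace (R : realType) (N : nat) : Type :=
  quotient_topology {eq_quot @proportional R 'cV[R]_N (nonzero R N)}.

HB.instance Definition _ (R : realType) (N : nat) :=
  Topological.copy (projspace R N)
    (quotient_topology {eq_quot @proportional R 'cV[R]_N (nonzero R N)}).
HB.instance Definition _ (R : realType) (N : nat) :=
  Quotient.copy (projspace R N)
    (quotient_topology {eq_quot @proportional R 'cV[R]_N (nonzero R N)}).

Section ProjSpace.
Variables (R : realType) (N : nat).

Definition projpt (v : 'cV[R]_N) (v0 : v != 0) : projspace R N :=
  \pi_(projspace R N) (exist _ v (mem_set v0) : nonzero R N).

(* The projectivization P(W) of a linear subspace W. *)
Definition proj_subspace (W : {vspace 'cV[R]_N}) : set (projspace R N) :=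
  [set x | exists (v : 'cV[R]_N) (v0 : v != 0), v \in W /\ x = projpt v0].

Definition proj_line (l : set (projspace R N)) : Prop :=
  exists2 W : {vspace 'cV[R]_N}, \dim W = 2 & l = proj_subspace W.

Lemma projpt_eq (u v : 'cV[R]_N) (u0 : u != 0) (v0 : v != 0) :
  projpt u0 = projpt v0 <-> exists2 c : R, c != 0 & v = c *: u.
Proof.
split=> [/eqmodP /asboolP //|h].
by apply/eqmodP/asboolP.
Qed.

End ProjSpace.

Section Wedge.
Variables (R : realType) (p n : nat).

Definition increasing (f : {ffun 'I_p -> 'I_n}) : bool :=
  [forall i : 'I_p, forall j : 'I_p, (i < j)%N ==> (f i < f j)%N].

(* The index set of the standard basis e_{i_1} /\ ... /\ e_{i_p},
   i_1 < ... < i_p, of the p-th exterior power of R^n. *)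
Definition wedge_index := {f : {ffun 'I_p -> 'I_n} | increasing f}.

Definition wedge_dim : nat := #|{: wedge_index}|.

Definition minor (v : p.-tuple 'cV[R]_n) (f : 'I_p -> 'I_n) : R :=
  \det (\matrix_(i < p, j < p) tnth v j (f i) 0).

(* v_1 /\ ... /\ v_p: its coordinates are the p x p minors of (v_1 ... v_p). *)
Definition wedge (v : p.-tuple 'cV[R]_n) : 'cV[R]_wedge_dim :=
  \col_(k < wedge_dim) minor v (val (@enum_val _ {: wedge_index} k)).

Lemma increasing_sort (f : 'I_p -> 'I_n) : injective f ->
  exists (g : wedge_index) (s : 'S_p), f =1 val g \o s.
Proof.
move=> finj; pose S := f @: 'I_p.
have cS : #|S| = p by rewrite card_imset // card_ord.
have sS i : f i \in S by apply: imset_f.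
pose g := [ffun i : 'I_p => enum_val (cast_ord (esym cS) i)].
have sorted_S : sorted ltn (map val (enum S)).
  apply: (subseq_sorted ltn_trans) (iota_ltn_sorted 0 n).
  by rewrite -val_enum_ord; apply: map_subseq; rewrite enumT; apply: filter_subseq.
have gincr : increasing g.
  apply/forallP=> i; apply/forallP=> j; apply/implyP=> ij.
  rewrite !ffunE /enum_val.
  have sz : size (map val (enum S)) = p by rewrite size_map -cardE.
  have szE (k : 'I_p) : (k < size (enum S))%N by rewrite -cardE cS.
  rewrite -(nth_map _ 0%N val (szE i)) -(nth_map _ 0%N val (szE j)).
  by apply: (sorted_ltn_nth ltn_trans) => //; rewrite inE sz.
have sinj : injective (fun i => cast_ord cS (enum_rank_in (sS i) (f i))).
  move=> i j /cast_ord_inj /(congr1 enum_val).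
  by rewrite !enum_rankK_in // => /finj.
exists (exist _ g gincr), (perm sinj) => i /=.
by rewrite permE ffunE cast_ordK enum_rankK_in.
Qed.

Lemma wedge_neq0 (v : p.-tuple 'cV[R]_n) : free v -> wedge v != 0.
Proof.
move=> fv; apply/eqP => w0.
have minor0 (g : wedge_index) : minor v (val g) = 0.
  move/colP: w0 => /(_ (enum_rank g)).
  by rewrite !mxE enum_rankK.
pose M : 'M[R]_(p, n) := \matrix_(i, j) tnth v i j 0.
have Mfree : row_free M.
  apply: inj_row_free => u uM0; apply/rowP => i; rewrite [RHS]mxE.
  apply: (freeP fv (u 0)) => {i}; apply/colP => j.
  move/rowP: uM0 => /(_ j); rewrite !mxE summxE => e; rewrite -[RHS]e.
  by apply: eq_bigr => i _; rewrite !mxE (tnth_nth 0).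
have MTfull : row_full M^T by rewrite /row_full mxrank_tr.
have := fullrowsub_unit MTfull.
have [g [s fgs]] := increasing_sort (@fullrankfun_inj _ _ _ _ MTfull).
rewrite (_ : rowsub _ _ =
  row_perm s (\matrix_(i, j) tnth v j (val g i) 0)); last first.
  by apply/matrixP => i j; rewrite !mxE fgs.
rewrite unitmxE row_permE det_mulmx -/(minor v (val g)) minor0 mulr0.
by rewrite unitr0.
Qed.

End Wedge.

Definition subspaces (R : realType) (p n : nat) : Type :=
  {U : {vspace 'cV[R]_n} | \dim U == p}.
HB.instance Definition _ (R : realType) (p n : nat) :=
  Choice.copy (subspaces R p n) {U : {vspace 'cV[R]_n} | \dim U == p}.

Section Plucker.
Variables (R : realType) (p n : nat).

Definition basis_tuple (U : subspaces R p n) : p.-tuple 'cV[R]_n :=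
  tcast (eqP (valP U)) (vbasis (val U)).

Lemma basis_tupleP (U : subspaces R p n) : basis_of (val U) (basis_tuple U).
Proof. by rewrite /basis_tuple val_tcast; exact: vbasisP. Qed.

Lemma wedge_basis_neq0 (U : subspaces R p n) (v : p.-tuple 'cV[R]_n) :
  basis_of (val U) v -> wedge v != 0.
Proof. by move=> /basis_free; exact: wedge_neq0. Qed.

(* Span(v_1, ..., v_p) |-> [v_1 /\ ... /\ v_p]; see plucker_basis. *)
Definition plucker (U : subspaces R p n) : projspace R (wedge_dim p n) :=
  projpt (wedge_basis_neq0 (basis_tupleP U)).

Lemma plucker_basis (U : subspaces R p n) (v : p.-tuple 'cV[R]_n)
    (bv : basis_of (val U) v) :
  plucker U = projpt (wedge_basis_neq0 bv).
Proof.
have bu := basis_tupleP U; set u := basis_tuple U in bu *.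
pose A : 'M[R]_p := \matrix_(i, j) coord u i (tnth v j).
have vE j : tnth v j = \sum_i A i j *: tnth u i.
  rewrite {1}(coord_basis bu (basis_mem bv (mem_tnth j v))).
  by apply: eq_bigr => i _; rewrite [A i j]mxE (tnth_nth 0 u).
have wE : wedge v = \det A *: wedge u.
  apply/colP => k; rewrite !mxE /minor mulrC -det_mulmx; congr (\det _).
  apply/matrixP => i j; rewrite !mxE vE summxE.
  by apply: eq_bigr => l _; rewrite !mxE mulrC.
apply/projpt_eq; exists (\det A); last exact: wE.
apply/eqP => A0; move: (wedge_basis_neq0 bv).
by rewrite wE A0 scale0r eqxx.
Qed.

End Plucker.
Arguments plucker {R p n}.

(* The Grassmannian, as a topological subspace of P(/\^p R^n). *)
Definition Gr (R : realType) (p n : nat) : Type :=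
  initial_topology (@plucker R p n).

HB.instance Definition _ (R : realType) (p n : nat) :=
  Topological.copy (Gr R p n) (initial_topology (@plucker R p n)).

Definition grspace (R : realType) (p n : nat) (U : Gr R p n) :
  {vspace 'cV[R]_n} := val (U : subspaces R p n).

Section Grassmannian.
Variables (R : realType) (p n : nat).
Implicit Types (U : Gr R p n) (Om : set (Gr R p n)).

Lemma dim_grspace U : \dim (grspace U) = p.
Proof. exact: (eqP (valP (U : subspaces R p n))). Qed.

Lemma grspace_inj : injective (@grspace R p n).
Proof. exact: val_inj. Qed.

Definition mkGr (U : {vspace 'cV[R]_n}) (dU : \dim U = p) : Gr R p n :=
  exist _ U (introT eqP dU) : subspaces R p n.

Definition gr_line (l : set (projspace R (wedge_dim p n))) : Prop :=
  proj_line l /\ l `<=` range (@plucker R p n).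

Definition Rproper Om : Prop :=
  forall l, gr_line l ->
  exists x y, [/\ x != y, (l `\` plucker @` Om) x & (l `\` plucker @` Om) y].

Definition chart (W0 : Gr R p n) : set (Gr R p n) :=
  [set U | (grspace U :&: grspace W0 = 0)%VS].

(* {u + T u : u in U0}; see memv_graph. *)
Definition graph (U0 W0 : {vspace 'cV[R]_n})
    (T : 'Hom(subvs_of U0, subvs_of W0)) : {vspace 'cV[R]_n} :=
  limg (linfun vsval + (linfun vsval \o T))%VF.

Lemma memv_graph (U0 W0 : {vspace 'cV[R]_n})
    (T : 'Hom(subvs_of U0, subvs_of W0)) v :
  v \in graph T <-> exists u : subvs_of U0, v = vsval u + vsval (T u).
Proof.
split=> [/memv_imgP[u _ ->]|[u ->]].
  by exists u; rewrite add_lfunE comp_lfunE !lfunE.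
apply/memv_imgP; exists u; first exact: memvf.
by rewrite add_lfunE comp_lfunE !lfunE.
Qed.

(* Convexity in the chart of W0, read in Hom(U0, W0) for an origin U0 of the
   chart; another origin changes the coordinates by an affine bijection. *)
Definition chart_convex (W0 : Gr R p n) Om : Prop :=
  exists2 U0, chart W0 U0 &
  convex_set [set T : 'Hom(subvs_of (grspace U0), subvs_of (grspace W0)) |
    exists2 U, Om U & grspace U = graph T].

End Grassmannian.

Definition GL (R : realType) (n : nat) : set 'M[R]_n := [set g | g \in unitmx].
Arguments GL : clear implicits.

(* GL_n(R) modulo nonzero scalars, with the quotient topology. *)
Definition PGL (R : realType) (n : nat) : Type :=
  quotient_topology {eq_quot @proportional R 'M[R]_n (GL R n)}.

HB.instance Definition _ (R : realType) (n : nat) :=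
  Topological.copy (PGL R n)
    (quotient_topology {eq_quot @proportional R 'M[R]_n (GL R n)}).
HB.instance Definition _ (R : realType) (n : nat) :=
  Quotient.copy (PGL R n)
    (quotient_topology {eq_quot @proportional R 'M[R]_n (GL R n)}).

Section PGLGroup.
Variables (R : realType) (n : nat).
Implicit Types (g h : GL R n) (x y z : PGL R n).
Local Notation cls := (\pi_(PGL R n)).

Lemma GLP g : val g \in unitmx.
Proof. exact: (set_mem (valP g)). Qed.

Definition mkGL (g : 'M[R]_n) (ug : g \in unitmx) : GL R n :=
  exist _ g (mem_set ug).

Lemma pgl_eq g h :
  cls g = cls h <-> exists2 c : R, c != 0 & val h = c *: val g.
Proof. by split=> [/eqmodP /asboolP //|H]; apply/eqmodP/asboolP. Qed.

Fact GL1_subproof : (1%:M : 'M[R]_n) \in unitmx. Proof. exact: unitmx1. Qed.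
Fact GLM_subproof g h : val g *m val h \in unitmx.
Proof. by rewrite unitmx_mul !GLP. Qed.
Fact GLV_subproof g : invmx (val g) \in unitmx.
Proof. by rewrite unitmx_inv GLP. Qed.

Definition pgl_one : PGL R n := cls (mkGL GL1_subproof).
Definition pgl_mul x y : PGL R n := cls (mkGL (GLM_subproof (repr x) (repr y))).
Definition pgl_inv x : PGL R n := cls (mkGL (GLV_subproof (repr x))).

Lemma pgl_repr g : exists2 c : R, c != 0 & val (repr (cls g)) = c *: val g.
Proof. by apply/pgl_eq; rewrite reprK. Qed.

Lemma pi_pgl_mul g h : pgl_mul (cls g) (cls h) = cls (mkGL (GLM_subproof g h)).
Proof.
have [c c0 eg] := pgl_repr g; have [d d0 eh] := pgl_repr h.
apply/esym/pgl_eq; exists (c * d); first by rewrite mulf_neq0.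
by rewrite /= eg eh -scalemxAl -scalemxAr scalerA.
Qed.

Lemma pi_pgl_inv g : pgl_inv (cls g) = cls (mkGL (GLV_subproof g)).
Proof.
have [c c0 eg] := pgl_repr g.
apply/esym/pgl_eq; exists c^-1; first by rewrite invr_eq0.
by rewrite /= eg invmxZ ?unitfE // -eg GLP.
Qed.

Lemma pgl_val_eq g h : val g = val h -> cls g = cls h.
Proof. by move=> /val_inj ->. Qed.

Fact pgl_mulA : associative pgl_mul.
Proof.
elim/quotW=> f; elim/quotW=> g; elim/quotW=> h.
rewrite (pi_pgl_mul g h) (pi_pgl_mul f g) (pi_pgl_mul f) (pi_pgl_mul _ h).
by apply: pgl_val_eq; rewrite /= mulmxA.
Qed.
Fact pgl_mul1 : left_id pgl_one pgl_mul.
Proof.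
by elim/quotW=> g; rewrite /pgl_one pi_pgl_mul; apply: pgl_val_eq; rewrite /= mul1mx.
Qed.
Fact pgl_mulr1 : right_id pgl_one pgl_mul.
Proof.
by elim/quotW=> g; rewrite /pgl_one pi_pgl_mul; apply: pgl_val_eq; rewrite /= mulmx1.
Qed.
Fact pgl_mulV : left_inverse pgl_one pgl_inv pgl_mul.
Proof.
elim/quotW=> g; rewrite pi_pgl_inv pi_pgl_mul; apply: pgl_val_eq.
by rewrite /= mulVmx ?GLP.
Qed.
Fact pgl_mulrV : right_inverse pgl_one pgl_inv pgl_mul.
Proof.
elim/quotW=> g; rewrite pi_pgl_inv pi_pgl_mul; apply: pgl_val_eq.
by rewrite /= mulmxV ?GLP.
Qed.

HB.instance Definition _ := isGroup.Build (PGL R n)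
  pgl_mulA pgl_mul1 pgl_mulr1 pgl_mulV pgl_mulrV.

End PGLGroup.

Section Action.
Variables (R : realType) (p n : nat).
Implicit Types (g h : GL R n) (x y : PGL R n) (U : Gr R p n).
Implicit Types (Om : set (Gr R p n)).
Local Notation cls := (\pi_(PGL R n)).

Definition gl_image (g : 'M[R]_n) (U : {vspace 'cV[R]_n}) : {vspace 'cV[R]_n} :=
  (linfun (mulmx g) @: U)%VS.

Lemma dim_gl_image g U : \dim (gl_image (val g) (grspace U)) = p.
Proof.
rewrite -[RHS](dim_grspace U); apply: limg_dim_eq.
rewrite (_ : lker _ = 0%VS) ?capv0 //.
apply/eqP/lker0P => u v; rewrite !lfunE /= => e.
by rewrite -(mulKmx (GLP g) u) e mulKmx ?GLP.
Qed.

Definition gl_act g U : Gr R p n := mkGr (dim_gl_image g U).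

(* Independent of the representative; see pi_pgl_act. *)
Definition pgl_act x U : Gr R p n := gl_act (repr x) U.

Lemma pi_pgl_act g U : pgl_act (cls g) U = gl_act g U.
Proof.
have [c c0 e] := pgl_repr g; apply: grspace_inj; rewrite /grspace /=.
apply/vspaceP => v; apply/memv_imgP/memv_imgP => -[u uU ->].
  by exists (c *: u); rewrite ?memvZ // !lfunE /= e -scalemxAl scalemxAr.
exists (c^-1 *: u); rewrite ?memvZ // !lfunE /= e -scalemxAl -scalemxAr.
by rewrite scalerA mulfV // scale1r.
Qed.

Lemma pgl_act1 U : pgl_act 1%g U = U.
Proof.
rewrite pi_pgl_act; apply: grspace_inj; rewrite /grspace /= /gl_image.
rewrite (_ : linfun _ = \1%VF) ?limg_id //; first exact: lim1g.
by apply/lfunP => u; rewrite !lfunE /= mul1mx.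
Qed.

Lemma pgl_actM x y U : pgl_act (x * y)%g U = pgl_act x (pgl_act y U).
Proof.
elim/quotW: x => g; elim/quotW: y => h.
rewrite [(_ * _)%g]pi_pgl_mul !pi_pgl_act; apply: grspace_inj.
rewrite /grspace /= /gl_image -limg_comp; congr (_ @: _)%VS.
by apply/lfunP => u; rewrite comp_lfunE !lfunE /= mulmxA.
Qed.

Definition Aut Om : set (PGL R n) := [set x | pgl_act x @` Om = Om].

Lemma Aut_group Om :
  Aut Om 1%g /\ forall x y, Aut Om x -> Aut Om y -> Aut Om (x * y^-1)%g.
Proof.
have actV y : cancel (pgl_act y : Gr R p n -> _) (pgl_act (y^-1)%g).
  by move=> U; rewrite -pgl_actM mulVg pgl_act1.
split=> [|x y xA yA].
  by rewrite /Aut /= (_ : pgl_act _ = id) ?image_id //; apply/funext/pgl_act1.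
have e : pgl_act (x * y^-1)%g @` (pgl_act y @` Om) = pgl_act x @` Om.
  rewrite image_comp; congr (_ @` _); apply/funext => U /=.
  by rewrite pgl_actM actV.
by move: e; rewrite [pgl_act y @` _]yA [pgl_act x @` _]xA.
Qed.

Definition cocompact Om : Prop :=
  exists K : set (Gr R p n), [/\ compact K, K `<=` Om &
    [set pgl_act x U | x in Aut Om & U in K] = Om].

End Action.

(* Discreteness of the subspace topology on A. *)
Definition discrete_subset (T : topologicalType) (A : set T) : Prop :=
  A `<=` isolated A.

(* Main.v *)
Require Import Defs.
From mathcomp Require Import all_boot all_order perm all_algebra.
From mathcomp Require Import all_classical all_reals all_analysis.
From mathcomp Require Import ring lra.

Set Implicit Arguments.
Unset Strict Implicit.
Unset Printing Implicit Defensive.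

Import Order.TTheory GRing.Theory Num.Theory.
Import numFieldNormedType.Exports.

Local Open Scope classical_set_scope.
Local Open Scope quotient_scope.
Local Open Scope ring_scope.

(** The automorphism group is non-discrete because it contains a one-parameter
group: rescaling the domain at a well-chosen boundary point shows that it is
projectively equivalent to a cone, and the dilations of that cone are a
continuous family of automorphisms.

A frame [G] adapted to a splitting of the ambient space into [U0] and [W0]
identifies the chart with the [p x p] matrices, [X] standing for the column span
of [G *m col_mx 1%:M X].  The domain becomes an open convex set [S], and the
projective group acts by matrix fractional linear maps.  The projective lines of
the Grassmannian that meet the chart are its affine lines with a rank-one
direction, together with one point at infinity each, so properness says that [S]
contains no such line ([lift_no_rank1_line]).

Boundary point.  The linear functionals bounded below on [S] form a convex cone,
and the absence of rank-one lines forces this cone to contain an invertible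
matrix ([bounded_below_unit]).  A small quadratic perturbation of such a
functional attains its minimum, at a boundary point [xi] where [S] has an
invertible normal [F] ([unit_support]).

Rescaling.  Fix [w] in [S] and let [q] tend to [xi] along the segment from [w],
say [q = xi + t (w - xi)].  Cocompactness gives an automorphism [h] carrying a
point [k] of a fixed compact set to [q]; following it by the dilation of ratio
[1 / t] at [xi] gives a projective map [g] with [g k = w].  It maps [S] to a
rescaled copy which contains [S] by convexity and still lies in the half-space
of normal [F] at [xi].  This is enough to bound [g] and its inverse, up to
scalars, independently of [t] ([projective_bound]): the absence of long rank-one
segments of [S] through [k] bounds some blocks, and the half-space bounds the
others because [F] is invertible.

Limit.  A cluster point [g] for [t] tending to [0] is therefore an invertible
matrix, and it maps [S] onto the increasing union of the rescaled copies, which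
is the open tangent cone of [S] at [xi].  That cone is preserved by every
dilation at [xi], so conjugating by [g] yields automorphisms of the domain
([cone_symmetry]).  They depend continuously on the ratio, are trivial only for
ratio [1], and hence accumulate at the identity
([one_parameter_nondiscrete]). *)

(** * Continuity and compactness for matrices *)

Section MatrixAnalysis.
Variable R : realType.

Lemma mx_normP m n (A : 'M[R]_(m, n)) (c : R) : 0 <= c ->
  (`|A| <= c) <-> (forall i j, `|A i j| <= c).
Proof.
move=> c0; rewrite [`|A|]/Num.norm /= mx_normrE; split=> [/bigmax_leP[_ h] i j|h].
  exact: (h (i, j)).
by apply/bigmax_leP; split=> // -[i j] _; exact: h.
Qed.

Lemma mx_norm_entry m n (A : 'M[R]_(m, n)) i j : `|A i j| <= `|A|.
Proof. exact: (mx_normP A (normr_ge0 A)).1. Qed.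

Lemma mulmx_norm m n q (A : 'M[R]_(m, n)) (B : 'M[R]_(n, q)) :
  `|A *m B| <= n%:R * `|A| * `|B|.
Proof.
apply/mx_normP => [|i j]; first by rewrite !mulr_ge0.
rewrite mxE (le_trans (ler_norm_sum _ _ _)) //.
rewrite -mulrA (_ : n%:R * _ = \sum_(k < n) (`|A| * `|B|)); last first.
  by rewrite sumr_const card_ord mulr_natl.
by apply: ler_sum => k _; rewrite normrM ler_pM // mx_norm_entry.
Qed.

Lemma mx_nbhsP m n (A : 'M[R]_(m, n)) (P : set 'M[R]_(m, n)) :
  nbhs A P <-> exists2 e : R, 0 < e & forall D, `|D| < e -> P (A + D).
Proof.
split=> [/nbhs_ballP|] [e /= e0 h]; last apply/nbhs_ballP; exists e => //= D.
  by move=> De; apply: h; rewrite -ball_normE /= opprD addrA subrr sub0r normrN.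
by rewrite -ball_normE /= => AD; rewrite -[D](subrK A) addrC; apply: h; rewrite distrC.
Qed.

Lemma cvg_sumR (I : Type) (r : seq I) (T : Type) (F : set_system T)
    {FF : Filter F} (f : I -> T -> R) (a : I -> R) :
  (forall i, f i @ F --> a i) ->
  (fun x => \sum_(i <- r) f i x) @ F --> \sum_(i <- r) a i.
Proof.
by move=> h; apply: cvg_big => [|i _]; [exact: add_continuous|exact: h].
Qed.

Lemma cvg_prodR (I : Type) (r : seq I) (T : Type) (F : set_system T)
    {FF : Filter F} (f : I -> T -> R) (a : I -> R) :
  (forall i, f i @ F --> a i) ->
  (fun x => \prod_(i <- r) f i x) @ F --> \prod_(i <- r) a i.
Proof.
by move=> h; apply: cvg_big => [|i _]; [exact: mul_continuous|exact: h].
Qed.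

Lemma cvg_mx_entries m n (T : Type) (F : set_system T) {FF : Filter F}
    (f : T -> 'M[R]_(m, n)) (A : 'M[R]_(m, n)) :
  (forall i j, (fun x => f x i j) @ F --> A i j) -> f @ F --> A.
Proof.
move=> h U [P AP sPU]; suff : \forall x \near F, forall ij, P ij.1 ij.2 (f x ij.1 ij.2).
  by apply: (@filterS _ F) => x hx; apply: sPU => i j; exact: (hx (i, j)).
by apply: filter_forall => -[i j] /=; apply: h; exact: AP.
Qed.

Lemma continuous_mx m n (T : topologicalType) (f : T -> 'M[R]_(m, n)) :
  (forall i j, continuous (fun x => f x i j)) -> continuous f.
Proof. by move=> h x; apply: (@cvg_mx_entries _ _ _ (nbhs x)) => i j; exact: h. Qed.

Lemma mulmx_continuous m n q (B : 'M[R]_(n, q)) :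
  continuous (fun A : 'M[R]_(m, n) => A *m B).
Proof.
apply: continuous_mx => i j.
under eq_fun do rewrite mxE.
move=> A; apply: (@cvg_sumR _ _ _ (nbhs A)) => k; apply: cvgMr_tmp.
exact: coord_continuous.
Qed.

Lemma mulmxl_continuous m n q (B : 'M[R]_(q, m)) :
  continuous (fun A : 'M[R]_(m, n) => B *m A).
Proof.
apply: continuous_mx => i j.
under eq_fun do rewrite mxE.
move=> A; apply: (@cvg_sumR _ _ _ (nbhs A)) => k; apply: cvgMl_tmp.
exact: coord_continuous.
Qed.

Lemma cvg_det n (T : Type) (F : set_system T) {FF : Filter F}
    (f : T -> 'M[R]_n) (A : 'M[R]_n) :
  f @ F --> A -> (fun x => \det (f x)) @ F --> \det A.
Proof.
move=> h; rewrite /determinant; apply: cvg_sumR => s; apply: cvgMl_tmp.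
apply: cvg_prodR => i.
exact: (cvg_comp _ _ h (@coord_continuous _ _ _ _ _ A)).
Qed.

Lemma unitmx_nbhs n (A : 'M[R]_n) : A \in unitmx ->
  \forall B \near A, B \in unitmx.
Proof.
rewrite unitmxE unitfE => dA.
have : (fun B : 'M[R]_n => \det B) @ A --> \det A.
  by apply: (@cvg_det _ _ (nbhs A) _ id A); exact: cvg_id.
move=> /(_ [set d | d != 0]) h.
have : nbhs A [set B : 'M[R]_n | \det B != 0].
  by apply: h; rewrite nbhsE; exists [set d | d != 0] => //; split=> //; exact: open_neq.
by apply: filterS => B /=; rewrite unitmxE unitfE.
Qed.

(** Flattening a matrix to a row vector makes the ball a product of segments. *)
Lemma mx_ball_compact m n (c : R) : compact [set A : 'M[R]_(m, n) | `|A| <= c].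
Proof.
have [c0|c0] := ltP c 0.
  rewrite (_ : mkset _ = set0); first exact: compact0.
  apply/seteqP; split=> // A /= h.
  by have := le_lt_trans (le_trans (normr_ge0 _) h) c0; rewrite ltxx.
pose S := [set v : 'rV[R]_(m * n) | forall i, v ord0 i \in `[(- c), c]].
have cS : compact S.
  by apply: (@rV_compact _ _ (fun=> `[(- c), c]%classic)) => _; exact: segment_compact.
have -> : [set A : 'M[R]_(m, n) | `|A| <= c] = vec_mx @` S.
  apply/seteqP; split=> [A /(mx_normP _ c0) h|_ [v Sv <-]]; last first.
    apply/mx_normP => // i j; rewrite mxE ler_norml.
    by have := Sv (mxvec_index i j); rewrite in_itv.
  exists (mxvec A); last by rewrite mxvecK.
  move=> k; case/mxvec_indexP: k => i j.
  by rewrite in_itv /= mxvecE -ler_norml; exact: h.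
apply: continuous_compact => //; apply: continuous_subspaceT.
apply: continuous_mx => i j.
by under eq_fun do rewrite mxE; exact: coord_continuous.
Qed.

End MatrixAnalysis.

(** * The trace inner product *)

Section Dot.
Variables (R : realType) (p : nat).
Implicit Types A B C : 'M[R]_p.

(** The Frobenius pairing; it is used both to write linear functionals on matrices
and to measure distances: unlike the maximum norm, it yields a normal vector at a
nearest point. *)
Definition dot A B : R := \tr (A^T *m B).

Lemma dotE A B : dot A B = \sum_i \sum_j A i j * B i j.
Proof.
rewrite /dot /mxtrace exchange_big; apply: eq_bigr => j _; rewrite mxE.
by apply: eq_bigr => i _; rewrite mxE.
Qed.

Lemma dotC A B : dot A B = dot B A.
Proof. by rewrite !dotE; do 2!apply: eq_bigr => ? _; rewrite mulrC. Qed.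

Lemma dotDr A B C : dot A (B + C) = dot A B + dot A C.
Proof. by rewrite /dot mulmxDr raddfD. Qed.

Lemma dotDl A B C : dot (A + B) C = dot A C + dot B C.
Proof. by rewrite dotC dotDr !(dotC C). Qed.

Lemma dotZr a A B : dot A (a *: B) = a * dot A B.
Proof. by rewrite /dot -scalemxAr mxtraceZ. Qed.

Lemma dotZl a A B : dot (a *: A) B = a * dot A B.
Proof. by rewrite dotC dotZr dotC. Qed.

Lemma dotNr A B : dot A (- B) = - dot A B.
Proof. by rewrite -scaleN1r dotZr mulN1r. Qed.

Lemma dotBr A B C : dot A (B - C) = dot A B - dot A C.
Proof. by rewrite dotDr dotNr. Qed.

Lemma dot0l B : dot 0 B = 0.
Proof. by rewrite -(scale0r 0) dotZl mul0r. Qed.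

Lemma dot_sqrD A B l :
  dot (A + l *: B) (A + l *: B) = dot A A + 2 * l * dot A B + l ^+ 2 * dot B B.
Proof. by rewrite dotDl !dotDr !dotZl !dotZr (dotC B A); ring. Qed.

Lemma dot_ge0 A : 0 <= dot A A.
Proof. by rewrite dotE; do 2!apply: sumr_ge0 => ? _; rewrite -expr2 sqr_ge0. Qed.

Lemma dot_norm A : `|A| ^+ 2 <= dot A A.
Proof.
rewrite -[leRHS](sqr_sqrtr (dot_ge0 A)) ler_pXn2r ?nnegrE ?sqrtr_ge0 //.
apply/mx_normP => [|i j]; first exact: sqrtr_ge0.
rewrite -sqrtr_sqr ler_wsqrtr // dotE (bigD1 i) //= (bigD1 j) //= -expr2.
rewrite -addrA lerDl addr_ge0 //; last apply: sumr_ge0 => k _.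
  by apply: sumr_ge0 => k _; rewrite -expr2 sqr_ge0.
by apply: sumr_ge0 => l _; rewrite -expr2 sqr_ge0.
Qed.

Lemma dot_eq0 A : dot A A <= 0 -> A = 0.
Proof.
move=> A0; apply/eqP; rewrite -normr_eq0 -sqrf_eq0 eq_le sqr_ge0 andbT.
exact: le_trans (dot_norm A) A0.
Qed.

(** A functional pairs with a rank-one direction as a bilinear form: this is what
relates its kernel vectors to the lines that the domain must not contain. *)
Lemma dot_rank1 A (x : 'cV[R]_p) (f : 'rV[R]_p) :
  dot A (x *m f) = (x^T *m A *m f^T) 0 0.
Proof.
rewrite dotC /dot trmx_mul -[f^T *m _ *m _]mulmxA mxtrace_mulC.
by rewrite [LHS]big_ord1.
Qed.

Lemma dot_continuous A : continuous (fun B => dot A B).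
Proof.
under eq_fun do rewrite dotE.
move=> B; apply: (@cvg_sumR _ _ _ _ (nbhs B)) => i.
apply: (@cvg_sumR _ _ _ _ (nbhs B)) => j.
by apply: cvgMl_tmp; exact: coord_continuous.
Qed.

Lemma sqr_dot_continuous : continuous (fun B => dot B B).
Proof.
under eq_fun do rewrite dotE.
move=> B; apply: (@cvg_sumR _ _ _ _ (nbhs B)) => i.
apply: (@cvg_sumR _ _ _ _ (nbhs B)) => j.
by apply: cvgM; exact: coord_continuous.
Qed.

(** The search may be restricted to a ball, on which the distance attains its
minimum by compactness. *)
Lemma nearest_point (S : set 'M[R]_p) (Z : 'M[R]_p) : closed S -> S !=set0 ->
  exists2 Y, S Y & forall X, S X -> dot (Y - Z) (Y - Z) <= dot (X - Z) (X - Z).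
Proof.
move=> cS [X0 SX0].
pose r := dot (X0 - Z) (X0 - Z).
pose T := S `&` [set X | `|X| <= `|Z| + (1 + r)].
have r0 : 0 <= r by exact: dot_ge0.
have T_of X : S X -> dot (X - Z) (X - Z) <= r -> T X.
  move=> SX Xr; split=> //=.
  rewrite -[X in `|X|](subrK Z) (le_trans (ler_normD _ _)) // addrC lerD2l.
  (* A nonnegative number with square at most [r] is at most [1 + r]. *)
  have : `|X - Z| ^+ 2 <= r := le_trans (dot_norm _) Xr.
  by have := normr_ge0 (X - Z); set u := `|_|; nra.
have cT : compact T.
  by rewrite /T setIC; apply: compact_closedI => //; exact: mx_ball_compact.
have T0 : T !=set0 by exists X0; exact: T_of.
pose f := fun X : 'M[R]_p => dot (X - Z) (X - Z).
have cf : {within T, continuous f}.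
  apply: continuous_subspaceT => X.
  apply: (cvg_comp (fun X : 'M[R]_p => X - Z) (fun B => dot B B)); last first.
    exact: sqr_dot_continuous.
  by apply: (@cvgB _ _ _ (nbhs X) _ id (fun=> Z)) => //; exact: cvg_cst.
have [Y /set_mem[SY _] Ymin] := compact_EVT_min T0 cT cf.
exists Y => // X SX; have [Xr|/ltW rX] := leP (dot (X - Z) (X - Z)) r.
  by apply: Ymin; rewrite inE; exact: T_of.
by apply: le_trans rX; apply: Ymin; rewrite inE; apply: T_of.
Qed.

End Dot.

(** * Supporting functionals of an open convex set of matrices *)

(** Compress to a complement of the kernel on each side, enlarged by the kernel
vectors [a] and [b].  There [F + e F1] becomes, after dividing the last rows by
[e], a matrix [N e] that at [e = 0] is block triangular with diagonal blocks the
identity of size [rank F] and the nonzero number [a F1 b]; it stays invertible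
for small [e]. *)
Lemma rank_perturb (R : realType) (p : nat) (F F1 : 'M[R]_p) (a : 'rV[R]_p)
    (b : 'cV[R]_p) :
  a *m F = 0 -> F *m b = 0 -> (a *m F1 *m b) 0 0 != 0 ->
  exists2 e : R, 0 < e & (\rank F < \rank (F + e *: F1)%R)%N.
Proof.
move=> aF Fb aF1b; set r := \rank F.
have [L eL] : exists L : 'M[R]_(r, p), L *m col_base F = 1%:M.
  by exists (pinvmx (col_base F)); rewrite mulVpmx // col_base_full.
have [S eS] : exists S : 'M[R]_(p, r), row_base F *m S = 1%:M.
  by exists (pinvmx (row_base F)); rewrite mulmxVp // row_base_free.
have LFS : L *m F *m S = 1%:M.
  by rewrite -[F in LHS](mulmx_base F) mulmxA eL mul1mx eS.
pose N (e : R) : 'M[R]_(r + 1) := block_mx (1%:M + e *: (L *m F1 *m S))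
  (e *: (L *m F1 *m b)) (a *m F1 *m S) (a *m F1 *m b).
have NE e : col_mx L a *m (F + e *: F1) *m row_mx S b =
    block_mx 1%:M 0 0 (e%:M) *m N e.
  rewrite mul_col_mx mul_col_row mulmx_block !mul1mx !mul0mx !addr0 !add0r.
  rewrite !mul_scalar_mx !mulmxDr !mulmxDl LFS aF mul0mx add0r.
  rewrite -[L *m F *m b]mulmxA Fb mulmx0 add0r mul0mx add0r.
  by rewrite -!scalemxAr -!scalemxAl.
have N0 : N 0 \in unitmx.
  rewrite /N !scale0r addr0 unitmxE det_lblock det1 mul1r unitfE.
  by rewrite det_mx11.
have Ncont : continuous N.
  apply: continuous_mx => i j x; rewrite /N.
  have -> : (fun y => N y i j) = fun y =>
     block_mx 1%:M 0 (a *m F1 *m S) (a *m F1 *m b) i j +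
     y * block_mx (L *m F1 *m S) (L *m F1 *m b) 0 0 i j.
    apply/funext => y; rewrite /N !mxE.
    by case: splitP => k _; rewrite !mxE; case: splitP => l _; rewrite !mxE; ring.
  apply: (@cvgD _ _ _ (nbhs x)); first exact: cvg_cst.
  by apply: (@cvgMr_tmp _ _ (nbhs x)).
have /nbhs_ballP[d /= d0 hd] := Ncont 0 _ (unitmx_nbhs N0).
exists (d / 2); first by lra.
have dN : N (d / 2) \in unitmx.
  apply: hd; rewrite -ball_normE /= sub0r normrN gtr0_norm; lra.
rewrite -addn1.
have uM : col_mx L a *m (F + (d / 2) *: F1) *m row_mx S b \in unitmx.
  rewrite NE unitmx_mul dN andbT unitmxE det_ublock det1 mul1r det_scalar1 unitfE.
  by apply: lt0r_neq0; lra.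
rewrite -(mxrank_unit uM).
apply: leq_trans (mxrankM_maxl _ _) _; exact: mxrankM_maxr.
Qed.

Section Convex.
Variables (R : realType) (p : nat).
Implicit Types X Y Z v F : 'M[R]_p.

Definition mxconvex (S : set 'M[R]_p) := forall X Y (l : R),
  0 < l -> l < 1 -> S X -> S Y -> S (X + l *: (Y - X)).

(** Replace the closure point [Y] by a nearby [Y'] of [S] and move [X] so that the
given point stays on the new segment; the displacement of [X] is within the ball
that openness provides. *)
Lemma convex_closure_segment (S : set 'M[R]_p) Y X l :
  open S -> mxconvex S -> closure S Y -> S X -> 0 < l -> l <= 1 ->
  S (Y + l *: (X - Y)).
Proof.
move=> oS cS clY SX l0; rewrite le_eqVlt => /predU1P[->|l1].
  by rewrite scale1r addrC subrK.
have /mx_nbhsP[e e0 he] : nbhs X S by apply: open_nbhs_nbhs.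
have [Y' [SY' YY']] : S `&` [set B | `|B - Y| < l * e] !=set0.
  apply: clY; apply/mx_nbhsP; exists (l * e); first exact: mulr_gt0.
  by move=> D; rewrite /= addrAC subrr add0r.
set D := Y' - Y in YY'.
pose D' := - ((1 - l) / l) *: D.
have SX' : S (X + D').
  apply: he; rewrite normrZ normrN ger0_norm; last by rewrite divr_ge0; lra.
  rewrite mulrAC ltr_pdivrMr //; have := normr_ge0 D; move: YY'; rewrite /= -/D; nra.
have -> : Y + l *: (X - Y) = Y' + l *: ((X + D') - Y').
  rewrite /D' /D; apply/matrixP => i j; rewrite !mxE.
  by field; apply: lt0r_neq0.
exact: cS.
Qed.

Lemma closure_line (S : set 'M[R]_p) X v :
  open S -> mxconvex S -> S X -> (forall t, closure S (X + t *: v)) ->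
  forall t, S (X + t *: v).
Proof.
move=> oS cS SX h t.
have := @convex_closure_segment S _ X (1 / 2) oS cS (h (2 * t)) SX.
have -> : X + (2 * t) *: v + (1 / 2) *: (X - (X + (2 * t) *: v)) = X + t *: v.
  by apply/matrixP => i j; rewrite !mxE; field.
by apply; lra.
Qed.

(** First-order optimality: moving from the nearest point [Y] of the closure
towards [X] cannot decrease the distance to [Z] to first order. *)
Lemma nearest_normal (S : set 'M[R]_p) Z : open S -> mxconvex S -> S !=set0 ->
  exists2 Y, closure S Y & forall X, S X -> 0 <= dot (Y - Z) (X - Y).
Proof.
move=> oS cS [X0 SX0].
have [|Y clY Ymin] := @nearest_point R p (closure S) Z (@closed_closure _ S).
  by exists X0; exact: subset_closure.
exists Y => // X SX; set d := dot _ _.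
have h l : 0 < l -> l <= 1 -> 0 <= 2 * d + l * dot (X - Y) (X - Y).
  move=> l0 l1; have /subset_closure/Ymin := convex_closure_segment oS cS clY SX l0 l1.
  rewrite addrAC dot_sqrD -/d.
  by set a := dot _ _; set b := dot _ _ => ?; nra.
have e0 := dot_ge0 (X - Y); set e := dot _ _ in e0 h.
have [//|d0] := leP 0 d.
(* A step this short makes the quadratic term smaller than the linear gain. *)
have := h (Num.min 1 (- d / (e + 1))).
have e1 : 0 < e + 1 by lra.
rewrite lt_min ltr01 divr_gt0 ?oppr_gt0 // ge_min lexx => /(_ isT isT).
have : Num.min 1 (- d / (e + 1)) * e <= - d.
  have := ge_min (- d / (e + 1)) 1 (- d / (e + 1)); rewrite lexx orbT => m1.
  apply: le_trans (ler_wpM2r e0 m1) _.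
  rewrite mulrAC ler_pdivrMr //; nra.
lra.
Qed.

Definition bounded_below (S : set 'M[R]_p) F :=
  exists c, forall X, S X -> c <= dot F X.

Definition no_rank1_line (S : set 'M[R]_p) := forall X (x : 'cV[R]_p) (f : 'rV[R]_p),
  x != 0 -> f != 0 -> S X -> exists t, ~ S (X + t *: (x *m f)).

(** Induct on the corank of a functional [F] bounded below on [S], starting from
the zero functional.  If [a] and [b] are left and right kernel vectors of [F],
the line through a point of [S] in the rank-one direction [a^T b^T] leaves the
closure of [S], say at [Z].  The normal [Y - Z] at the point [Y] of the closure
nearest to [Z] is also bounded below on [S], and [a (Y - Z) b] cannot vanish:
otherwise the normal would be constant along the line and would not separate [Z]
from [S].  Adding a small multiple of it to [F] increases the rank. *)
Lemma bounded_below_unit (S : set 'M[R]_p) : open S -> mxconvex S -> S !=set0 ->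
  no_rank1_line S -> exists2 F, F \in unitmx & bounded_below S F.
Proof.
move=> oS cS S0 nS.
suff H m F : (p - \rank F <= m)%N -> bounded_below S F ->
    exists2 F, F \in unitmx & bounded_below S F.
  apply: (H p 0); first by rewrite mxrank0 subn0.
  by exists 0 => X _; rewrite dot0l.
elim: m F => [|m IH] F rF bF.
  exists F => //; rewrite -row_free_unit /row_free eqn_leq rank_leq_row.
  by rewrite -subn_eq0 -leqn0.
have [uF|nuF] := boolP (F \in unitmx); first by exists F.
have [a a0 aF] : exists2 a : 'rV[R]_p, a != 0 & a *m F = 0.
  have : kermx F != 0 by rewrite kermx_eq0 row_free_unit.
  by move=> /rowV0Pn[a /sub_kermxP aF a0]; exists a.
have [b b0 Fb] : exists2 b : 'cV[R]_p, b != 0 & F *m b = 0.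
  have : kermx F^T != 0 by rewrite kermx_eq0 row_free_unit unitmx_tr.
  move=> /rowV0Pn[b /sub_kermxP bFt b0]; exists b^T; first by rewrite trmx_eq0.
  by apply: trmx_inj; rewrite trmx_mul trmxK bFt trmx0.
have [X0 SX0] := S0.
have [t nt] : exists t, ~ closure S (X0 + t *: (a^T *m b^T)).
  apply/existsNP => h; have at0 : a^T != 0 by rewrite trmx_eq0.
  have bt0 : b^T != 0 by rewrite trmx_eq0.
  have [t] := nS _ _ _ at0 bt0 SX0; apply; exact: closure_line.
set Z := X0 + _ in nt.
have [Y clY hY] := @nearest_normal S Z oS cS S0.
have bF1 : bounded_below S (Y - Z).
  by exists (dot (Y - Z) Y) => X /hY; rewrite dotBr subr_ge0.
have aF1b : (a *m (Y - Z) *m b) 0 0 != 0.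
  apply/eqP => e0; apply: nt; suff /eqP : Y - Z = 0 by rewrite subr_eq0 => /eqP <-.
  apply: dot_eq0; have := hY _ SX0.
  have -> : X0 - Y = - (Y - Z) - t *: (a^T *m b^T).
    by rewrite /Z opprB addrAC addrK.
  move: e0; set W := Y - Z => e0.
  by rewrite dotBr dotNr dotZr dot_rank1 !trmxK e0 mulr0 subr0 oppr_ge0.
have [e e0 re] := rank_perturb aF Fb aF1b.
apply: (IH (F + e *: (Y - Z))).
  by rewrite leq_subLR (leq_trans _ (leq_add re (leqnn m))) // addSnnS -leq_subLR.
case: bF => c hc; case: bF1 => c1 hc1; exists (c + e * c1) => X SX.
by rewrite dotDl dotZl lerD ?hc // ler_pM2l // hc1.
Qed.

Lemma closure_dot_le (S : set 'M[R]_p) F c Y : closure S Y ->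
  (forall X, S X -> c <= dot F X) -> c <= dot F Y.
Proof.
move=> clY h; rewrite leNgt; apply/negP => Fc.
have nY : nbhs Y [set X | dot F X < c].
  apply: (@dot_continuous R p F Y [set d | d < c]).
  by apply: open_nbhs_nbhs; split=> //; exact: open_lt.
by have [X [SX /=]] := clY _ nY; rewrite ltNge h.
Qed.

(** The infimum of a functional [F] bounded below on [S] need not be attained, but
that of [F X + (e / 2) |X - X0|^2] is, at the point [Y] of the closure nearest to
[X0 - F / e].  The normal there is proportional to [F + e (Y - X0)], and
comparing values at [Y] and [X0] shows that [e |Y - X0|] is of order [sqrt e], so
the normal is as invertible as [F] once [e] is small. *)
Lemma unit_support (S : set 'M[R]_p) :
  (0 < p)%N -> open S -> mxconvex S -> S !=set0 -> no_rank1_line S ->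
  exists Y F, [/\ closure S Y, F \in unitmx &
  forall X, S X -> 0 < dot F (X - Y)].
Proof.
move=> p0 oS cS S0 nS; have [X0 SX0] := S0.
have [F uF [c hc]] := bounded_below_unit oS cS S0 nS.
have /mx_nbhsP[d d0 hd] := unitmx_nbhs uF.
pose k := dot F X0 - c.
have k0 : 0 <= k by rewrite subr_ge0 hc.
(* With this choice [e * k] is below [d ^+ 2], the square of the radius in which
   perturbations of [F] stay invertible. *)
pose e := d ^+ 2 / (k + 1).
have e0 : 0 < e by rewrite divr_gt0 ?exprn_gt0 //; lra.
have [Y clY hY] := @nearest_normal S (X0 - e^-1 *: F) oS cS S0.
set N := Y - _ in hY.
have eN : e *: N = F + e *: (Y - X0).
  by rewrite /N opprB addrCA scalerDr scalerA mulfV ?gt_eqF // scale1r.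
have uN : e *: N \in unitmx.
  rewrite eN; apply: hd; rewrite -(@ltr_pXn2r _ 2) ?nnegrE ?(ltW d0) //.
  apply: le_lt_trans (dot_norm _) _; rewrite dotZl dotZr.
  have : 0 <= dot (e *: N) (X0 - Y) by rewrite dotZl mulr_ge0 ?hY // ltW.
  have := closure_dot_le clY hc; rewrite eN -(opprB Y X0).
  have -> : dot F Y = dot F X0 + dot F (Y - X0) by rewrite dotBr addrC subrK.
  set V := Y - X0; rewrite dotNr dotDl dotZl; set u := dot V V => h1 h2.
  have : e * u <= k by rewrite /k; lra.
  move=> euk; apply: (@le_lt_trans _ _ (e * k)); first by rewrite ler_pM2l.
  rewrite /e mulrAC ltr_pdivrMr; last by lra.
  have := exprn_gt0 2 d0; nra.
exists Y, (e *: N); split=> // X SX.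
have N0 : 0 < dot N N.
  rewrite lt0r dot_ge0 andbT; apply/eqP => N0.
  have N00 : N = 0 by apply: dot_eq0; rewrite N0.
  move: uN; rewrite N00 scaler0 unitmxE.
  by case: (p) p0 => // p' _; rewrite det0 unitr0.
have /mx_nbhsP[r r0 hr] : nbhs X S by apply: open_nbhs_nbhs.
(* [S] is open, so a step from [X] against the normal stays in [S] and turns the
   weak inequality into a strict one. *)
pose s := r / (2 * (`|N| + 1)).
have nN := normr_ge0 N.
have s0 : 0 < s by rewrite divr_gt0 //; lra.
have /hY : S (X + (- s) *: N).
  apply: hr; rewrite normrZ normrN gtr0_norm // /s mulrAC ltr_pdivrMr; last by lra.
  nra.
rewrite dotZl addrAC; set V := X - Y.
by rewrite dotDr dotZr => h; apply: mulr_gt0 => //; nra.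
Qed.

End Convex.

(** * Fractional linear maps in the chart *)

Section Chart.
Variables (R : realType) (p : nat).
Implicit Types X Y Z E B C F : 'M[R]_p.

Definition chart_pt X : 'M[R]_(p + p, p) := col_mx 1%:M X.
Definition chart_coord (A : 'M[R]_(p + p, p)) : 'M[R]_p := dsubmx A *m invmx (usubmx A).

Lemma chart_coordK (A : 'M[R]_(p + p, p)) : usubmx A \in unitmx ->
  chart_pt (chart_coord A) *m usubmx A = A.
Proof. by move=> uA; rewrite mul_col_mx mul1mx mulmxKV // vsubmxK. Qed.

Lemma usub_chart_pt X C : usubmx (chart_pt X *m C) = C.
Proof. by rewrite mul_col_mx col_mxKu mul1mx. Qed.

Lemma chart_ptKM X C : C \in unitmx -> chart_coord (chart_pt X *m C) = X.
Proof. by move=> uC; rewrite /chart_coord usub_chart_pt mul_col_mx col_mxKd mulmxK. Qed.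

(** Along a rank-one segment a matrix fractional linear map is a scalar one: with
[m = f C0^-1 B x], the Sherman-Morrison formula gives
[t x f (C0 + t B x f)^-1 = t / (1 + t m) x f C0^-1].  If the denominators are
invertible for [|t| <= 1] then [|m| < 1], and [t / (1 + t m)] takes every value of
absolute value at most [1 / 2]. *)
Lemma rank1_fraction C0 B E (x : 'cV[R]_p) (f : 'rV[R]_p) : C0 \in unitmx ->
  (forall t : R, `|t| <= 1 -> C0 + B *m (t *: (x *m f)) \in unitmx) ->
  `|(f *m invmx C0 *m B *m x) 0 0| < 1 /\
  forall s : R, `|s| <= 1 / 2 -> exists2 t : R, `|t| <= 1 &
    E *m (t *: (x *m f)) *m invmx (C0 + B *m (t *: (x *m f)))
    = s *: ((E *m x) *m (f *m invmx C0)).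
Proof.
move=> uC0 h; set m := _ 0 0.
have mE : f *m invmx C0 *m B *m x = m%:M by exact: mx11_scalar.
have m1 : `|m| < 1.
  rewrite ltNge; apply/negP => m1.
  have m0 : m != 0 by rewrite -normr_gt0; lra.
  have u := h (- m^-1); rewrite normrN normfV invf_le1 ?normr_gt0 // in u.
  have [y [C0y fy]] : exists y : 'cV[R]_p, C0 *m y = B *m x /\ f *m y = m%:M.
    by exists (invmx C0 *m B *m x); rewrite -mE !mulmxA mulmxV // mul1mx.
  have y0 : (C0 + B *m (- m^-1 *: (x *m f))) *m y = 0.
    rewrite mulmxDl -scalemxAr -scalemxAl C0y -!mulmxA fy mul_mx_scalar.
    by rewrite -scalemxAr scalerA mulNr mulVf // scaleN1r subrr.
  have := mulKmx (u m1) y; rewrite y0 mulmx0 => y00.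
  move: fy; rewrite -y00 mulmx0 => /matrixP/(_ 0 0); rewrite !mxE eqxx mulr1n.
  by move=> /esym m00; rewrite m00 eqxx in m0.
split=> // s s2.
have sm : `|s * m| < 1 / 2.
  by rewrite normrM; have := normr_ge0 s; have := normr_ge0 m; nra.
have sm0 : 1 - s * m != 0.
  by apply: lt0r_neq0; move: sm; rewrite ltr_norml; lra.
(* The solution of [t / (1 + t * m) = s]. *)
pose t := s / (1 - s * m).
have t1 : `|t| <= 1.
  rewrite normrM normfV ler_pdivrMr ?normr_gt0 // mul1r.
  move: sm; rewrite ltr_norml => /andP[sm1 sm2].
  by rewrite (ger0_norm (x := 1 - _)); lra.
exists t => //; have ut := h t t1; set D := C0 + _ in ut *.
have fD : f *m invmx C0 *m D = (1 + t * m) *: f.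
  rewrite mulmxDr mulmxKV // -2!scalemxAr !mulmxA mE mul_scalar_mx.
  by rewrite scalerA scalerDl scale1r.
have tm0 : 1 + t * m != 0.
  have -> : 1 + t * m = (1 - s * m)^-1 by rewrite /t; field.
  by rewrite invr_eq0.
have -> : f *m invmx C0 = (1 + t * m) *: (f *m invmx D).
  by rewrite scalemxAl -fD mulmxK.
rewrite -!scalemxAr scalerA -scalemxAl !mulmxA; congr (_ *: _).
by rewrite /t; field.
Qed.

(** Suppose that [G] sends the point [a] of the chart to the point [b].  In the
splittings of source and target by [chart_pt a], [chart_pt b] and the vertical
subspace, [G] is upper block triangular; this is its lower right block, and the
differential of the induced map at [a] is [Z |-> adapted_block G b Z C0^-1]. *)
Definition adapted_block (G : 'M[R]_(p + p)) b : 'M[R]_p := drsubmx G - b *m ursubmx G.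

Lemma mul_chart_pt (G : 'M[R]_(p + p)) a b C0 Z :
  G *m chart_pt a = chart_pt b *m C0 ->
  G *m chart_pt (a + Z) =
    chart_pt b *m (C0 + ursubmx G *m Z) + col_mx 0 (adapted_block G b *m Z).
Proof.
move=> e; have -> : chart_pt (a + Z) = chart_pt a + col_mx 0 Z.
  by rewrite /chart_pt add_col_mx addr0.
rewrite mulmxDr e mulmxDr -addrA; congr (_ + _).
rewrite -[in LHS](submxK G) mul_block_col !mulmx0 !add0r mul_col_mx mul1mx.
by rewrite add_col_mx addr0 mulmxBl mulmxA addrC subrK.
Qed.

Lemma usub_mul_chart_pt (G : 'M[R]_(p + p)) a b C0 Z :
  G *m chart_pt a = chart_pt b *m C0 ->
  usubmx (G *m chart_pt (a + Z)) = C0 + ursubmx G *m Z.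
Proof.
by move=> e; rewrite (mul_chart_pt _ e) mul_col_mx add_col_mx col_mxKu mul1mx addr0.
Qed.

Lemma chart_coord_mul (G : 'M[R]_(p + p)) a b C0 Z :
  G *m chart_pt a = chart_pt b *m C0 ->
  C0 + ursubmx G *m Z \in unitmx ->
  chart_coord (G *m chart_pt (a + Z)) =
    b + adapted_block G b *m Z *m invmx (C0 + ursubmx G *m Z).
Proof.
move=> e u; rewrite /chart_coord (usub_mul_chart_pt _ e) (mul_chart_pt _ e).
rewrite mul_col_mx add_col_mx.
by rewrite col_mxKd mulmxDl mulmxK.
Qed.

(** The version of [rank1_fraction] for projective maps: a set containing the image
of a rank-one segment about [a] contains a rank-one segment about [b] whose
direction is given by the blocks of [G] and whose length does not degenerate. *)
Lemma disc_transfer (G : 'M[R]_(p + p)) a b C0 (Q : 'M[R]_p -> Prop) (x : 'cV[R]_p)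
    (f : 'rV[R]_p) : C0 \in unitmx -> G *m chart_pt a = chart_pt b *m C0 ->
  (forall t : R, `|t| <= 1 -> usubmx (G *m chart_pt (a + t *: (x *m f))) \in unitmx /\
     Q (chart_coord (G *m chart_pt (a + t *: (x *m f))))) ->
  `|(f *m invmx C0 *m ursubmx G *m x) 0 0| < 1 /\
  forall s : R, `|s| <= 1 / 2 ->
     Q (b + s *: ((adapted_block G b *m x) *m (f *m invmx C0))).
Proof.
move=> uC0 e h; set B := ursubmx G; set E := adapted_block G b.
have u t : `|t| <= 1 -> C0 + B *m (t *: (x *m f)) \in unitmx.
  by move=> /h[]; rewrite (usub_mul_chart_pt _ e).
have [m1 hs] := rank1_fraction E uC0 u; split=> // s /hs[t t1 <-].
by have [_] := h _ t1; rewrite (chart_coord_mul e) //; exact: u.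
Qed.

(** Inverse block triangular matrices have inverse diagonal blocks. *)
Lemma adapted_block_inv (G g : 'M[R]_(p + p)) a b C0 : G *m g = 1%:M ->
  G *m chart_pt a = chart_pt b *m C0 -> adapted_block G b *m adapted_block g a = 1%:M.
Proof.
move=> Gg e.
have blockE (h : 'M[R]_(p + p)) c :
    adapted_block h c = row_mx (- c) 1%:M *m h *m col_mx 0 1%:M.
  rewrite -[in RHS](submxK h) mul_row_block mul_row_col !mulmx0 !mul1mx mulmx1 add0r.
  by rewrite mulNmx addrC.
have split1 c : col_mx 0 1%:M *m row_mx (- c) 1%:M =
    1%:M - chart_pt c *m row_mx 1%:M 0 :> 'M[R]_(p + p).
  rewrite (scalar_mx_block p p 1) !mul_col_row !mul0mx !mul1mx mulmx1 !mulmx0.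
  by rewrite opp_block_mx add_block_mx !oppr0 !addr0 subrr add0r.
rewrite !blockE.
set r := row_mx _ _; set s := row_mx _ _; set k := col_mx _ _.
have -> : r *m G *m k *m (s *m g *m k) = r *m G *m (k *m s) *m (g *m k).
  by rewrite !mulmxA.
rewrite split1 mulmxBr mulmx1 mulmxBl -(mulmxA r G (chart_pt a *m _)) (mulmxA G) e.
have -> : r *m (chart_pt b *m C0 *m row_mx 1%:M (0 : 'M[R]_p)) = 0.
  rewrite -(mulmxA (chart_pt b)) (mulmxA r) /r /chart_pt mul_row_col.
  by rewrite mulmx1 mul1mx addNr mul0mx.
by rewrite mul0mx subr0 mulmxA -(mulmxA r) Gg mulmx1 /r /k mul_row_col mulmx0 add0r mulmx1.
Qed.

(** Entries are values of the bilinear form on coordinate vectors scaled to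
length [r / 2]. *)
Lemma mulmx_delta_bound (N : 'M[R]_p) (r c : R) : 0 < r -> 0 <= c ->
  (forall (x : 'cV[R]_p) (f : 'rV[R]_p), `|x *m f| < r -> `|(f *m N *m x) 0 0| <= c) ->
  `|N| <= 2 * c / r.
Proof.
move=> r0 c0 h; apply/mx_normP => [|i j].
  by rewrite divr_ge0 ?mulr_ge0 // ltW.
pose d : 'cV[R]_p := delta_mx j 0; pose f : 'rV[R]_p := delta_mx 0 i.
have fNd : (f *m N *m ((r / 2) *: d)) 0 0 = r / 2 * N i j.
  by rewrite -scalemxAr mxE -rowE -colE !mxE.
have h1 : `|((r / 2) *: d) *m f| <= r / 2.
  rewrite -scalemxAl mul_delta_mx normrZ gtr0_norm; last by lra.
  rewrite ler_piMr //; first by lra.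
  by apply/mx_normP => // k l; rewrite mxE; case: (_ && _); rewrite ?normr1 ?normr0.
have := h ((r / 2) *: d) f; rewrite fNd.
move=> /(_ _)/wrap[]; first by apply: le_lt_trans h1 _; lra.
rewrite normrM gtr0_norm; last by lra.
by move=> h2; rewrite ler_pdivlMr //; lra.
Qed.

Lemma norm_entries_prod m n (A : 'M[R]_m) (B : 'M[R]_n) c : 0 <= c ->
  (forall i j k l, `|A i j| * `|B k l| <= c) -> `|A| * `|B| <= c.
Proof.
move=> c0 h; have [->|B0] := eqVneq B 0; first by rewrite normr0 mulr0.
rewrite -ler_pdivlMr ?normr_gt0 //; apply/mx_normP => [|i j].
  by rewrite divr_ge0.
rewrite ler_pdivlMr ?normr_gt0 // mulrC.
have [->|Aij] := eqVneq (A i j) 0; first by rewrite normr0 mulr0.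
rewrite -ler_pdivlMr ?normr_gt0 //; apply/mx_normP => [|k l].
  by rewrite divr_ge0.
by rewrite ler_pdivlMr ?normr_gt0 // mulrC.
Qed.

Lemma norm_block m1 m2 n1 n2 (A : 'M[R]_(m1, n1)) (B : 'M[R]_(m1, n2))
    (C : 'M[R]_(m2, n1)) (D : 'M[R]_(m2, n2)) c : 0 <= c ->
  `|A| <= c -> `|B| <= c -> `|C| <= c -> `|D| <= c -> `|block_mx A B C D| <= c.
Proof.
move=> c0 hA hB hC hD; apply/mx_normP => // i j.
by rewrite !mxE; case: splitP => k _; rewrite !mxE; case: splitP => l _;
  apply: (le_trans (mx_norm_entry _ _ _)).
Qed.

End Chart.

(** * Uniform bound for the rescaled maps *)

Section Bounds.
Variables (R : realType) (p : nat).
Implicit Types X Y Z E B C F N : 'M[R]_p.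

Lemma mulmx_norm_le (m n q : nat) (A : 'M[R]_(m, n)) (B : 'M[R]_(n, q)) a b :
  `|A| <= a -> `|B| <= b -> `|A *m B| <= n%:R * a * b.
Proof.
move=> ha hb; apply: le_trans (mulmx_norm A B) _.
by rewrite -!mulrA ler_wpM2l // ler_pM.
Qed.

(** Undoing the changes of splitting costs only the sizes of [a] and [b]. *)
Lemma norm_adapted_blocks (G : 'M[R]_(p + p)) a b C0 (ca cb c : R) :
  G *m chart_pt a = chart_pt b *m C0 -> 0 <= c -> `|a| <= ca -> `|b| <= cb ->
  `|C0| <= c -> `|ursubmx G| <= c -> `|adapted_block G b| <= c ->
  `|G| <= (c + p%:R * cb * c) * (1 + p%:R * ca).
Proof.
move=> e c0 ha hb hC hB hE.
have ca0 : 0 <= ca by apply: le_trans ha.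
have cb0 : 0 <= cb by apply: le_trans hb.
have p0 : 0 <= p%:R :> R by [].
have hEb : `|drsubmx G| <= c + p%:R * cb * c.
  have -> : drsubmx G = adapted_block G b + b *m ursubmx G by rewrite subrK.
  by rewrite (le_trans (ler_normD _ _)) // lerD // mulmx_norm_le.
have hBb : `|ursubmx G| <= c + p%:R * cb * c.
  by rewrite (le_trans hB) // lerDl !mulr_ge0.
have /eq_col_mx[e1 e2] :
    col_mx (ulsubmx G + ursubmx G *m a) (dlsubmx G + drsubmx G *m a) =
    col_mx C0 (b *m C0).
  rewrite -[X in _ = X](_ : chart_pt b *m C0 = _); last by rewrite mul_col_mx mul1mx.
  by rewrite -e -[in RHS](submxK G) mul_block_col !mulmx1.
set k := c + _ in hEb hBb *.
have k0 : 0 <= k by rewrite /k addr_ge0 // !mulr_ge0.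
have kk : k <= k * (1 + p%:R * ca) by rewrite ler_peMr // lerDl mulr_ge0.
rewrite -(submxK G); apply: norm_block.
- exact: le_trans kk.
- have -> : ulsubmx G = C0 - ursubmx G *m a by rewrite -e1 addrK.
  rewrite (le_trans (ler_normB _ _)) // mulrDr mulr1 lerD //.
    by rewrite (le_trans hC) // lerDl !mulr_ge0.
  by rewrite mulrCA mulrA mulmx_norm_le.
- exact: le_trans kk.
- have -> : dlsubmx G = b *m C0 - drsubmx G *m a by rewrite -e2 addrK.
  rewrite (le_trans (ler_normB _ _)) // mulrDr mulr1 lerD //.
    by rewrite (le_trans (mulmx_norm_le hb hC)) // lerDr.
  by rewrite mulrCA mulrA mulmx_norm_le.
- exact: le_trans kk.
Qed.

(** Write [G] and [g] in splittings adapted to [w] and [k], with blocks [C0, B, E]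
for [G] and [D = C0^-1, B', E' = E^-1] for [g].  Rank-one segments of the ball
about [w] are sent by [G] to segments of [S] about [k] with direction
[(E x) (h D)]; as these have bounded length, [|E| |D|] is bounded, and
nonvanishing of the denominators bounds [D B].  Rank-one segments of the ball
about [k] are sent by [g] into the half-space, which bounds [N = C0 F^T E'], and
their denominators bound [C0 B'].

Normalise by [s = |D|].  Then [s E] and [s^-1 D] are bounded; since [F] is
invertible, so are [s C0 = N (s E) F^-T] and [s^-1 E' = F^-T (s^-1 D) N]; and the
remaining blocks are [s B = (s C0) (D B)] and [s^-1 B' = (s^-1 D) (C0 B')].  The
bound depends only on the data quantified before it. *)
Lemma projective_bound (w xi F : 'M[R]_p) (eps rho T ck : R) :
  (0 < p)%N -> F \in unitmx -> 0 < eps -> 0 < rho -> 0 <= T -> 0 <= ck ->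
  0 <= dot F (w - xi) ->
  exists c, forall (S : set 'M[R]_p) (G g : 'M[R]_(p + p)) k C0,
    G *m g = 1%:M -> C0 \in unitmx -> G *m chart_pt w = chart_pt k *m C0 -> `|k| <= ck ->
    (forall Z, `|Z| < eps -> usubmx (G *m chart_pt (w + Z)) \in unitmx /\
       S (chart_coord (G *m chart_pt (w + Z)))) ->
    (forall Z, `|Z| < rho -> usubmx (g *m chart_pt (k + Z)) \in unitmx /\
       0 < dot F (chart_coord (g *m chart_pt (k + Z)) - xi)) ->
    (forall (x : 'cV[R]_p) (f : 'rV[R]_p),
       (forall s : R, `|s| <= 1 / 2 -> S (k + s *: (x *m f))) -> `|x| * `|f| <= T) ->
    exists2 a : R, a != 0 & `|a *: G| <= c /\ `|a^-1 *: g| <= c.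
Proof.
move=> p0 uF eps0 rho0 T0 ck0 k0.
set kap := dot F (w - xi) in k0.
pose cE := 2 * T / eps.
pose cN := 2 * (2 * kap) / rho.
pose P : R := p%:R.
pose f := `|invmx F|.
pose cC := P * (P * cN * cE) * f.
pose cB := P * cC * (2 * 1 / eps).
pose cE' := P * (P * f * 1) * cN.
pose cB' := P * 1 * (2 * 1 / rho).
pose c1 := cE + cC + cB + cE' + 1 + cB'.
have P0 : 0 <= P by [].
have f0 : 0 <= f by exact: normr_ge0.
have cE0 : 0 <= cE by rewrite divr_ge0 ?mulr_ge0 // ltW.
have cN0 : 0 <= cN by rewrite divr_ge0 ?mulr_ge0 // ltW.
have cC0 : 0 <= cC by repeat (done || apply: mulr_ge0).
have cB0 : 0 <= cB by rewrite /cB mulr_ge0 ?divr_ge0 ?(mulr_ge0 P0) // ltW.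
have cE'0 : 0 <= cE' by repeat (done || apply: mulr_ge0).
have cB'0 : 0 <= cB' by rewrite /cB' mulr_ge0 ?divr_ge0 ?(mulr_ge0 P0) // ltW.
pose cA := (c1 + P * ck * c1) * (1 + P * `|w|).
pose cA' := (c1 + P * `|w| * c1) * (1 + P * ck).
have c10 : 0 <= c1 by rewrite /c1 !addr_ge0.
exists (cA + cA') => S G g k C0 Gg uC eG hk hS hH hT.
have gG : g *m G = 1%:M by apply: mulmx1C.
have eg : g *m chart_pt k = chart_pt w *m invmx C0.
  by rewrite -[chart_pt k](mulmxK uC) -eG !mulmxA gG mul1mx.
have uC' : invmx C0 \in unitmx by rewrite unitmx_inv.
have small (t r : R) (x : 'cV[R]_p) (h : 'rV[R]_p) : `|x *m h| < r -> `|t| <= 1 ->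
    `|t *: (x *m h)| < r.
  by move=> xh t1; rewrite normrZ; apply: le_lt_trans xh; rewrite ler_piMl.
pose E := adapted_block G k; pose B := ursubmx G.
pose E' := adapted_block g w; pose B' := ursubmx g.
have EE' : E *m E' = 1%:M by apply: adapted_block_inv eG.
have discS (x : 'cV[R]_p) (h : 'rV[R]_p) : `|x *m h| < eps ->
    `|(h *m (invmx C0 *m B) *m x) 0 0| <= 1 /\ `|E *m x| * `|h *m invmx C0| <= T.
  move=> xh; have [|b1 b2] := disc_transfer (Q := S) (x := x) (f := h) uC eG.
    by move=> t t1; apply: hS; exact: small.
  by split; [rewrite mulmxA ltW|exact: hT].
have discH (x : 'cV[R]_p) (h : 'rV[R]_p) : `|x *m h| < rho ->
    `|(h *m (C0 *m B') *m x) 0 0| <= 1 /\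
    `|(h *m (C0 *m F^T *m E') *m x) 0 0| <= 2 * kap.
  move=> xh.
  have [|b1 b2] := disc_transfer (Q := fun Y => 0 < dot F (Y - xi)) (x := x) (f := h) uC' eg.
    by move=> t t1; apply: hH; exact: small.
  rewrite invmxK in b1 b2; split; first by rewrite mulmxA ltW.
  set v := _ 0 0.
  have hv s : `|s| <= 1 / 2 -> 0 < kap + s * v.
    move=> /b2; rewrite addrAC dotDr dotZr dot_rank1 -/kap; congr (0 < _ + _ * _).
    by rewrite /v -[in RHS](trmxK (_ *m x)) [RHS]mxE !trmx_mul !trmxK !mulmxA.
  (* An affine function of [s] positive for [s = 1 / 2] and [s = - 1 / 2]. *)
  have half : `|1 / 2| <= 1 / 2 :> R by rewrite ger0_norm //; lra.
  have h2 := hv _ half; rewrite -normrN in half; have h1 := hv _ half.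
  by rewrite ler_norml; apply/andP; split; lra.
pose D := invmx C0.
have D0 : D != 0.
  apply/eqP => D0; move: uC'; rewrite -/D D0 unitmxE.
  by case: (p) p0 => // p' _; rewrite det0 unitr0.
pose s := `|D|; have s0 : 0 < s by rewrite normr_gt0.
have hDB : `|D *m B| <= 2 * 1 / eps.
  by apply: mulmx_delta_bound => // x h /discS[].
have hCB' : `|C0 *m B'| <= 2 * 1 / rho.
  by apply: mulmx_delta_bound => // x h /discH[].
pose N := C0 *m F^T *m E'.
have hN : `|N| <= cN.
  by apply: mulmx_delta_bound => // [|x h /discH[]//]; rewrite mulr_ge0.
(* Coordinate vectors [x], [h] isolate a column of [E] and a row of [D]. *)
have hED : `|E| * `|D| <= cE.
  apply: norm_entries_prod => // i j l m.
  pose d : 'cV[R]_p := delta_mx j 0; pose h : 'rV[R]_p := delta_mx 0 l.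
  have h1 : `|((eps / 2) *: d) *m h| < eps.
    rewrite -scalemxAl mul_delta_mx normrZ gtr0_norm; last by lra.
    apply: (@le_lt_trans _ _ (eps / 2 * 1)); last by lra.
    rewrite ler_pM2l; last by lra.
    by apply/mx_normP => // a b; rewrite mxE; case: (_ && _); rewrite ?normr1 ?normr0.
  have [_] := discS _ _ h1; rewrite -scalemxAr -colE -rowE normrZ gtr0_norm; last by lra.
  have := mx_norm_entry (col j E) i 0; have := mx_norm_entry (row l D) 0 m.
  rewrite [col j E i 0]mxE [row l D 0 m]mxE => h2 h3 h4; rewrite /cE ler_pdivlMr //.
  have := ler_pM (normr_ge0 _) (normr_ge0 _) h3 h2.
  set u := `|E i j| * _; move: h4; rewrite -/D; set y := `|col j E|; set z := `|row l D|.
  nra.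
have hE : `|s *: E| <= cE by rewrite normrZ gtr0_norm // mulrC.
have hD : `|s^-1 *: D| <= 1.
  by rewrite normrZ gtr0_norm ?invr_gt0 // mulVf // gt_eqF.
have uFT : F^T \in unitmx by rewrite unitmx_tr.
have nFT : `|invmx F^T| <= f.
  rewrite -trmx_inv; apply/mx_normP => // i j; rewrite mxE; exact: mx_norm_entry.
have C0E : C0 = N *m E *m invmx F^T.
  by rewrite /N -(mulmxA _ E') (mulmx1C EE') mulmx1 mulmxK.
have E'E : E' = invmx F^T *m D *m N.
  by rewrite /N !mulmxA -(mulmxA _ D) mulVmx // mulmx1 mulVmx // mul1mx.
have hC : `|s *: C0| <= cC.
  by rewrite C0E scalemxAl scalemxAr !mulmx_norm_le.
have hB : `|s *: B| <= cB.
  rewrite -[B](mulKVmx uC) scalemxAl; exact: mulmx_norm_le.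
have hE' : `|s^-1 *: E'| <= cE'.
  by rewrite E'E scalemxAl scalemxAr !mulmx_norm_le.
have hB' : `|s^-1 *: B'| <= cB'.
  rewrite -[B'](mulKmx uC) scalemxAl; exact: mulmx_norm_le.
have scal (H : 'M[R]_(p + p)) a b C (r : R) : H *m chart_pt a = chart_pt b *m C ->
   (r *: H) *m chart_pt a = chart_pt b *m (r *: C).
  by move=> e; rewrite -scalemxAl e scalemxAr.
exists s; first by rewrite gt_eqF.
clearbody cE cC cB cE' cB'.
have [l1 l2 l3] : [/\ cE <= c1, cC <= c1 & cB <= c1] by rewrite /c1; split; lra.
have [l4 l5 l6] : [/\ cE' <= c1, 1 <= c1 & cB' <= c1] by rewrite /c1; split; lra.
have cA0 : 0 <= cA by repeat (done || apply: mulr_ge0 || apply: addr_ge0).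
have cA'0 : 0 <= cA' by repeat (done || apply: mulr_ge0 || apply: addr_ge0).
have offZ (H : 'M[R]_(p + p)) r : ursubmx (r *: H) = r *: ursubmx H.
  by apply/matrixP => i j; rewrite !mxE.
have blockZ (H : 'M[R]_(p + p)) r b : adapted_block (r *: H) b = r *: adapted_block H b.
  rewrite /adapted_block offZ -scalemxAr scalerBr.
  by congr (_ - _); apply/matrixP => i j; rewrite !mxE.
split.
  apply: (@le_trans _ _ cA); last by lra.
  apply: (norm_adapted_blocks (scal _ _ _ _ s eG)) => //.
  - exact: le_trans l2.
  - by rewrite offZ; exact: le_trans l3.
  - by rewrite blockZ; exact: le_trans l1.
apply: (@le_trans _ _ cA'); last by lra.
apply: (norm_adapted_blocks (scal _ _ _ _ s^-1 eg)) => //.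
- exact: le_trans l5.
- by rewrite offZ; exact: le_trans l6.
- by rewrite blockZ; exact: le_trans l4.
Qed.

End Bounds.

(** * Uniform estimates on compact sets *)

Lemma compact_seq_cluster (T : topologicalType) (K : set T) (u : nat -> T) :
  compact K -> (forall n, K (u n)) ->
  exists2 c, K c & forall V, nbhs c V -> forall m, exists2 n, (m <= n)%N & V (u n).
Proof.
move=> cK Ku; have [c [Kc cl]] := cK (u @ \oo) _ (filterE _ Ku).
exists c => // V nV m.
have /(cl _ _)/(_ nV) : (u @ \oo) [set u n | n in [set n | (m <= n)%N]].
  by exists m => // n /= mn; exists n.
by move=> [_ [[n /= mn <-] Vn]]; exists n.
Qed.

Section Uniform.
Variables (R : realType) (p : nat).

Lemma uniform_ball (S K : set 'M[R]_p) : open S -> compact K -> K `<=` S ->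
  exists2 r : R, 0 < r & forall k Z, K k -> `|Z| < r -> S (k + Z).
Proof.
move=> oS cK KS.
have ncK := (compact_near_coveringP K).1 cK.
have h : \forall r \near (0 : R)^'+, K `<=` [set k | forall Z, `|Z| < r -> S (k + Z)].
  apply: ncK => k Kk.
  have /mx_nbhsP[e e0 he] : nbhs k S by apply: open_nbhs_nbhs; split=> //; exact: KS.
  exists ([set k' | `|k' - k| < e / 2], [set r | r < e / 2]).
    split => /=; last by apply: nbhs_right_lt; rewrite divr_gt0.
    apply/mx_nbhsP; exists (e / 2); first by rewrite divr_gt0.
    by move=> D; rewrite /= addrAC subrr add0r.
  move=> [k' r] [/= h1 h2] Z Zr; have -> : k' + Z = k + ((k' - k) + Z).
    by rewrite addrA (addrC k) subrK.
  by apply: he; rewrite (le_lt_trans (ler_normD _ _)) //; lra.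
near (0 : R)^'+ => r; exists r; first by near: r; exact: nbhs_right_gt.
by move=> k Z Kk; apply: (near h r) => //; near: r.
Unshelve. all: by end_near. Qed.

Lemma normalize_mx m n (A : 'M[R]_(m, n)) : A != 0 ->
  `|(`|A|^-1 *: A)| = 1.
Proof. by move=> A0; rewrite normrZ normfV normr_id mulVf // normr_eq0. Qed.

Lemma compact_sphere m n : compact [set A : 'M[R]_(m, n) | `|A| = 1].
Proof.
have -> : [set A : 'M[R]_(m, n) | `|A| = 1] =
    [set A | `|A| <= 1] `&` (Num.norm @^-1` [set 1]).
  by apply/seteqP; split => [A /= ->|A []].
apply: compact_closedI; first exact: mx_ball_compact.
apply: preimage_closed; last exact: closed_eq.
by move=> A _; exact: norm_continuous.
Qed.

Lemma rank1_line_continuous (t : R) : continuous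
  (fun z : 'M[R]_p * ('cV[R]_p * 'rV[R]_p) => z.1 + t *: (z.2.1 *m z.2.2)).
Proof.
apply: continuous_mx => i j.
under eq_fun do rewrite !mxE big_ord1.
move=> z; apply: cvgD; last apply: cvgMl_tmp; last apply: cvgM.
- apply: (cvg_comp (fun z : 'M[R]_p * ('cV[R]_p * 'rV[R]_p) => z.1)
     (fun A : 'M[R]_p => A i j)); [exact: cvg_fst|exact: coord_continuous].
- apply: (cvg_comp (fun z : 'M[R]_p * ('cV[R]_p * 'rV[R]_p) => z.2.1)
     (fun x : 'cV[R]_p => x i 0)); last exact: coord_continuous.
  exact: (cvg_comp _ _ cvg_snd cvg_fst).
- apply: (cvg_comp (fun z : 'M[R]_p * ('cV[R]_p * 'rV[R]_p) => z.2.2)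
     (fun x : 'rV[R]_p => x 0 j)); last exact: coord_continuous.
  exact: (cvg_comp _ _ cvg_snd cvg_snd).
Qed.

(** For each base point and unit rank-one direction the line leaves the closure of
[S] at some finite parameter; this is an open condition, so by compactness one
parameter bound serves them all. *)
Lemma uniform_rank1_bound (S K : set 'M[R]_p) : open S -> mxconvex S ->
  no_rank1_line S -> compact K -> K `<=` S ->
  exists2 T : R, 0 <= T & forall k (x : 'cV[R]_p) (f : 'rV[R]_p), K k ->
   (forall s : R, `|s| <= 1 / 2 -> S (k + s *: (x *m f))) -> `|x| * `|f| <= T.
Proof.
move=> oS cS nS cK KS.
pose K3 := K `*` ([set x : 'cV[R]_p | `|x| = 1] `*` [set f : 'rV[R]_p | `|f| = 1]).
have cK3 : compact K3.
  by apply: compact_setX => //; apply: compact_setX; exact: compact_sphere.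
have h : \forall T \near +oo, K3 `<=` [set z | exists2 t : R, `|t| < T &
    ~ closure S (z.1 + t *: (z.2.1 *m z.2.2))].
  apply: ((compact_near_coveringP K3).1 cK3) => -[k [x f]] [/= Kk [x1 f1]].
  have x0 : x != 0 by rewrite -normr_gt0 x1.
  have f0 : f != 0 by rewrite -normr_gt0 f1.
  have [t nt] : exists t, ~ closure S (k + t *: (x *m f)).
    apply/existsNP => h; have [t] := nS _ _ _ x0 f0 (KS _ Kk); apply.
    exact: closure_line (KS _ Kk) h t.
  have nz : nbhs (k + t *: (x *m f)) (~` closure S).
    by apply: open_nbhs_nbhs; split=> //; exact/closed_openC/closed_closure.
  have := @rank1_line_continuous t (k, (x, f)) _ nz => nz'.
  exists ((fun z : 'M[R]_p * ('cV[R]_p * 'rV[R]_p) => z.1 + t *: (z.2.1 *m z.2.2)) @^-1`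
    (~` closure S), [set T | `|t| < T]).
    by split => //=; exact: nbhs_pinfty_gt.
  by move=> [z T] [/= h1 h2]; exists t.
near (+oo : set_system R) => T; have T0 : 0 < T by near: T; exact: nbhs_pinfty_gt.
exists (2 * T); first by rewrite mulr_ge0 // ltW.
move=> k x f Kk hs; rewrite leNgt; apply/negP => Txf.
have x0 : x != 0 by apply/eqP => x0; move: Txf; rewrite x0 normr0 mul0r; lra.
have f0 : f != 0 by apply/eqP => f0; move: Txf; rewrite f0 normr0 mulr0; lra.
have [] := near h T _ (k, (`|x|^-1 *: x, `|f|^-1 *: f)).
- by [].
- by split => //; split; exact: normalize_mx.
move=> t /= tT; apply; apply: subset_closure.
rewrite -scalemxAl -scalemxAr !scalerA; apply: hs.
have xf0 : 0 < `|x| * `|f| by rewrite mulr_gt0 // normr_gt0.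
rewrite -mulrA -invfM normrM normfV (gtr0_norm xf0) ler_pdivrMr //; lra.
Unshelve. all: by end_near. Qed.

End Uniform.

(** * Dilations and the tangent cone *)

Section Dilation.
Variables (R : realType) (p : nat).
Implicit Types X xi : 'M[R]_p.

(** A matrix of the homothety of centre [xi] and ratio [s] of the chart; it is
normalised so that [dil xi] is multiplicative in the ratio. *)
Definition dil xi (s : R) : 'M[R]_(p + p) :=
  block_mx 1%:M 0 ((1 - s) *: xi) s%:M.

Lemma dil_chart_pt xi s X : dil xi s *m chart_pt X = chart_pt (xi + s *: (X - xi)).
Proof.
rewrite /dil mul_block_col !mulmx1 mul0mx addr0 mul_scalar_mx; congr (col_mx _ _).
by rewrite scalerBr scalerBl scale1r addrAC addrA.
Qed.

Lemma dilM xi s t : dil xi s *m dil xi t = dil xi (s * t).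
Proof.
rewrite /dil mulmx_block !mulmx1 !mul0mx !mulmx0 !addr0 !add0r.
rewrite -scalar_mxM; congr (block_mx _ _ _ _).
by rewrite mul_scalar_mx scalerA -scalerDl; congr (_ *: _); ring.
Qed.

Lemma dil1 xi : dil xi 1 = 1%:M.
Proof. by rewrite /dil subrr scale0r -scalar_mx_block. Qed.

End Dilation.

(** The domain is handled through the set [O] of all matrices whose column span
belongs to it.  It is stable by invertible column operations, and automorphisms are the
invertible matrices preserving it; fractional linear maps and their denominators
are thereby replaced by products of matrices. *)
Section ConeSymmetry.
Variables (R : realType) (p : nat) (p_gt0 : (0 < p)%N).
Variable O : set 'M[R]_(p + p, p).
Hypothesis oO : open O.
Hypothesis OM : forall A C, O A -> C \in unitmx -> O (A *m C).
Hypothesis OU : forall A, O A -> usubmx A \in unitmx.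
Let S : set 'M[R]_p := [set X | O (chart_pt X)].
Hypothesis S0 : S !=set0.
Hypothesis cS : mxconvex S.
Hypothesis nS : no_rank1_line S.
Variable K : set 'M[R]_p.
Hypothesis cK : compact K.
Hypothesis KS : K `<=` S.
Hypothesis orbitK : forall Y, S Y -> exists (h : 'M[R]_(p + p)) X C,
  [/\ h \in unitmx, K X, h *m chart_pt X = chart_pt Y *m C &
    forall A, O A <-> O (h *m A)].

Let oS : open S.
Proof.
rewrite openE => X SX; have /mx_nbhsP[e e0 he] : nbhs (chart_pt X) O by apply: open_nbhs_nbhs.
apply/mx_nbhsP; exists e => // D De; rewrite /S /=.
have -> : chart_pt (X + D) = chart_pt X + col_mx 0 D.
  by rewrite /chart_pt add_col_mx addr0.
apply: he; apply: le_lt_trans De; apply/mx_normP => // i j.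
by rewrite mxE; case: splitP => k _; rewrite ?mxE ?normr0 // mx_norm_entry.
Qed.

Let OE A : O A <-> usubmx A \in unitmx /\ S (chart_coord A).
Proof.
split=> [OA|[uA SA]]; last by rewrite -(chart_coordK uA); exact: OM.
have uA := OU OA; split=> //; rewrite /S /=.
have -> : chart_pt (chart_coord A) = A *m invmx (usubmx A).
  by rewrite -[X in _ = X *m _](chart_coordK uA) mulmxK.
by apply: OM => //; rewrite unitmx_inv.
Qed.

Let OZ A (c : R) : c != 0 -> O A -> O (c *: A).
Proof.
move=> c0 OA; rewrite -mul_mx_scalar; apply: OM => //.
by rewrite unitmxE det_scalar unitfE expf_neq0.
Qed.

(** The rescaling argument.  The maps [g_ n] carry the domain onto its image under
the dilation of ratio [1 / t_ n] at [xi], and are normalised so that they and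
their inverses lie in one compact ball.  A cluster point [g] is invertible, and it carries
[O] onto the lift [TC] of the tangent cone at [xi]: in one direction [A] in [O]
stays in [O] after replacing it by the close matrix [g_ n^-1 g A]; in the other,
dilations of ratio at most [1] preserve [O], so if [dil xi t] sends a matrix into [O], then so
does [dil xi t'] for every smaller positive [t'].  In both directions the
passage from [g] to [g_ n] is possible because [O] is open. *)
Lemma cone_symmetry : exists xi g, g \in unitmx /\ forall s : R, 0 < s ->
  forall A, O A <-> O (invmx g *m dil xi s *m g *m A).
Proof.
have [w Sw] := S0.
have [xi [F [clxi uF hF]]] := unit_support p_gt0 oS cS S0 nS.
have [eps eps0 heps] : exists2 e : R, 0 < e & forall Z, `|Z| < e -> S (w + Z).
  by apply/mx_nbhsP; apply: open_nbhs_nbhs.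
have [rho rho0 hrho] := uniform_ball oS cK KS.
have [T T0 hT] := uniform_rank1_bound oS cS nS cK KS.
have [ck ck0 hck] : exists2 c : R, 0 <= c & forall k, K k -> `|k| <= c.
  have [M [Mr hM]] := compact_bounded cK.
  exists (`|M| + 1) => // k /hM; apply; have := ler_norm M; lra.
have [c hc] := projective_bound p_gt0 uF eps0 rho0 T0 ck0 (ltW (hF _ Sw)).
(* Dilations at a closure point contract an open convex set into itself. *)
have dilO t A : 0 < t -> t <= 1 -> O A -> O (dil xi t *m A).
  move=> t0 t1 /[dup]/OE[uA SA] OA.
  rewrite -(chart_coordK uA) mulmxA dil_chart_pt; apply: OM => //.
  exact: (convex_closure_segment oS cS clxi SA t0 t1).
(* [dil xi t *m g] is an automorphism, and [G] is the inverse of [g]. *)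
have step (t : R) : 0 < t -> t <= 1 -> exists g G : 'M[R]_(p + p), exists a : R,
    [/\ a != 0, G *m g = 1%:M, `|a *: G| <= c, `|a^-1 *: g| <= c &
    forall A, O A <-> O (dil xi t *m (g *m A))].
  move=> t0 t1; have tn0 : t != 0 by rewrite gt_eqF.
  have Sq : S (xi + t *: (w - xi)) by exact: (convex_closure_segment oS cS clxi Sw t0 t1).
  have [h [k [C [uh Kk hk hO]]]] := orbitK Sq.
  have uC : C \in unitmx.
    have /hO/OU := KS Kk; by rewrite hk usub_chart_pt.
  pose g := dil xi t^-1 *m h; pose G := invmx h *m dil xi t.
  have Gg : G *m g = 1%:M.
    rewrite /G /g mulmxA -(mulmxA _ (dil xi t)) dilM mulfV // dil1 mulmx1.
    by rewrite mulVmx.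
  have eg : g *m chart_pt k = chart_pt w *m C.
    rewrite /g -mulmxA hk mulmxA dil_chart_pt addrAC subrr add0r scalerA mulVf //.
    by rewrite scale1r addrC subrK.
  have gO A : O A <-> O (dil xi t *m (g *m A)).
    by rewrite /g !mulmxA dilM mulfV // dil1 mul1mx.
  clearbody g G.
  have eG : G *m chart_pt w = chart_pt k *m invmx C.
    by rewrite -[chart_pt w](mulmxK uC) -eg !mulmxA Gg mul1mx.
  have [|||||||a a0 [haG hag]] := hc S G g k (invmx C) => //.
  - by rewrite unitmx_inv.
  - exact: hck.
  - move=> Z /heps SZ; apply/OE/gO.
    rewrite (mulmxA g) (mulmx1C Gg) mul1mx; exact: dilO.
  - move=> Z Zr; have SZ : O (chart_pt (k + Z)) := hrho _ _ Kk Zr.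
    have /gO/OE[] := SZ; set A := g *m _.
    have -> : usubmx (dil xi t *m A) = usubmx A.
      by rewrite -[in LHS](vsubmxK A) mul_block_col mul1mx mul0mx addr0 col_mxKu.
    move=> uA; rewrite -[in chart_coord _](chart_coordK uA) mulmxA.
    rewrite dil_chart_pt chart_ptKM // => /hF.
    by rewrite addrAC subrr add0r dotZr pmulr_rgt0.
  - by move=> x f; exact: hT.
  by exists g, G, a; split.
pose t_ n : R := n.+1%:R^-1.
have t0 n : 0 < t_ n by rewrite invr_gt0.
have t1 n : t_ n <= 1 by rewrite invf_le1 // ler1n.
(* The scalar [a] is moved into [g_ n] and [G], so that both are bounded; in the
   equivalence it reappears as a harmless factor. *)
have [|g_ hg_] := @choice _ _ (fun n (g : 'M[R]_(p + p)) =>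
    exists G : 'M[R]_(p + p), exists a : R,
    [/\ a != 0, G *m g = 1%:M, `|G| <= c, `|g| <= c &
    forall A, O A <-> O (dil xi (t_ n) *m (a *: (g *m A)))]).
  move=> n.
  have [g [G [a [a0 Gg haG hag hA]]]] := step _ (t0 n) (t1 n).
  exists (a^-1 *: g), (a *: G), a; split=> //.
    by rewrite -scalemxAl -scalemxAr scalerA mulfV // scale1r.
  by move=> A; rewrite -scalemxAl scalerA mulfV // scale1r.
have gc n : [set g : 'M[R]_(p + p) | `|g| <= c] (g_ n) by have [G [a []]] := hg_ n.
have [g _ clg] := compact_seq_cluster (@mx_ball_compact R _ _ c) gc.
have c0 : 0 <= c by have [G [a [_ _ h _ _]]] := hg_ 0%N; exact: le_trans h.
pose n2 : R := (p + p)%:R.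
have n20 : 0 <= n2 by [].
have near_g (d : R) m : 0 < d -> exists2 n, (m <= n)%N & `|g - g_ n| < d.
  move=> d0; have : nbhs g [set g' | `|g - g'| < d].
    apply/mx_nbhsP; exists d => // D; by rewrite /= opprD addrA subrr sub0r normrN.
  by move=> /clg/(_ m).
have ug : g \in unitmx.
  have /mx_nbhsP[d d0 hd] := unitmx_nbhs (unitmx1 R (p + p)).
  have [|n _ gn] := near_g (d / (n2 * c + 1)) 0%N.
    by rewrite divr_gt0 // ltr_wpDl // mulr_ge0.
  have [G [a [_ Gg hG _ _]]] := hg_ n.
  have : G *m g \in unitmx.
    have -> : G *m g = 1%:M + G *m (g - g_ n) by rewrite mulmxBr Gg addrC subrK.
    apply: hd; apply: le_lt_trans (mulmx_norm_le hG (ltW gn)) _.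
    rewrite mulrA ltr_pdivrMr ?ltr_wpDl ?mulr_ge0 // -/n2; nra.
  by rewrite unitmx_mul => /andP[].
pose TC A := exists2 t : R, 0 < t & O (dil xi t *m A).
have OTC A : O A <-> TC (g *m A).
  split=> [OA|[t tt0 OtA]].
    have /mx_nbhsP[d d0 hd] : nbhs A O by apply: open_nbhs_nbhs.
    have k0 : 0 <= n2 * (n2 * c) * `|A| by rewrite !mulr_ge0.
    have [|n _ gn] := near_g (d / (n2 * (n2 * c) * `|A| + 1)) 0%N.
      by rewrite divr_gt0 // ltr_wpDl.
    have [G [a [a0 Gg hG _ hO]]] := hg_ n.
    have : O (G *m (g *m A)).
      have -> : G *m (g *m A) = A + G *m (g - g_ n) *m A.
        by rewrite mulmxBr mulmxBl Gg mul1mx addrC subrK mulmxA.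
      apply: hd.
      apply: le_lt_trans (mulmx_norm_le (mulmx_norm_le hG (ltW gn)) (lexx _)) _.
      rewrite -/n2; set e := d / _ in gn *; set u := `|A| in k0 e gn *.
      have -> : n2 * (n2 * c * e) * u = n2 * (n2 * c) * u * e by ring.
      rewrite /e mulrA ltr_pdivrMr; last by lra.
      nra.
    move=> /hO; rewrite (mulmxA (g_ n)) (mulmx1C Gg) mul1mx -scalemxAr => h.
    exists (t_ n) => //; have := OZ (invr_neq0 a0) h.
    by rewrite scalerA mulVf // scale1r.
  have /mx_nbhsP[d d0 hd] : nbhs (dil xi t *m (g *m A)) O by apply: open_nbhs_nbhs.
  pose u := n2 * `|dil xi t| ; pose v := n2 * `|A|.
  have u0 : 0 <= u by rewrite mulr_ge0.
  have v0 : 0 <= v by rewrite mulr_ge0.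
  have [m tm] : exists m, forall n, (m <= n)%N -> t_ n <= t.
    have [m tm] : exists m, t^-1 <= m.+1%:R.
      exists (Num.truncn t^-1); apply/ltW; exact: truncnS_gt.
    exists m => n mn; rewrite /t_ -[leRHS]invrK lef_pV2 ?posrE ?invr_gt0 //.
    by apply: le_trans tm _; rewrite ler_nat ltnS.
  have [|n mn gn] := near_g (d / (u * v + 1)) m.
    by rewrite divr_gt0 // ltr_wpDl // mulr_ge0.
  have [G [a [a0 Gg hG _ hO]]] := hg_ n.
  have h1 : O (dil xi t *m (g_ n *m A)).
    have -> : dil xi t *m (g_ n *m A) =
        dil xi t *m (g *m A) + dil xi t *m ((g_ n - g) *m A).
      by rewrite -mulmxDr mulmxBl addrC subrK.
    rewrite distrC in gn.
    apply: hd.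
    apply: le_lt_trans (mulmx_norm_le (lexx _) (mulmx_norm_le (ltW gn) (lexx _))) _.
    rewrite -/n2 -/u; set e := d / _.
    have -> : u * (n2 * e * `|A|) = u * v * e by rewrite /v; ring.
    have uv0 : 0 <= u * v by rewrite mulr_ge0.
    rewrite /e mulrA ltr_pdivrMr; last by lra.
    nra.
  apply/hO; rewrite -scalemxAr; apply: OZ => //.
  have := @dilO (t_ n / t) _ _ _ h1; rewrite mulmxA dilM divfK ?gt_eqF // => h2.
  apply: h2; first by rewrite divr_gt0.
  by rewrite ler_pdivrMr // mul1r tm.
exists xi, g; split=> // s s0 A.
rewrite OTC (OTC (_ *m A)) !mulmxA mulmxV // mul1mx; split=> -[t tt0].
  move=> h; exists (t / s); first by rewrite divr_gt0.
  by rewrite !mulmxA dilM divfK ?gt_eqF // -mulmxA.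
rewrite !mulmxA dilM -mulmxA => h; exists (t * s) => //; exact: mulr_gt0.
Qed.

End ConeSymmetry.

(** * Subspaces as column spans *)

Section Colspan.
Variables (R : realType) (p n : nat).
Implicit Types A B : 'M[R]_(n, p).

Definition colspan A : {vspace 'cV[R]_n} := limg (linfun (mulmx A : 'cV[R]_p -> 'cV[R]_n)).

Lemma memv_colspan A v : reflect (exists y : 'cV[R]_p, v = A *m y) (v \in colspan A).
Proof.
apply: (iffP memv_imgP) => [[y _ ->]|[y ->]]; exists y; rewrite ?memvf ?lfunE //.
Qed.

Definition cols A : p.-tuple 'cV[R]_n := [tuple col j A | j < p].

Lemma tnth_cols A j : tnth (cols A) j = col j A.
Proof. by rewrite tnth_mktuple. Qed.

Lemma mulmx_cols A (y : 'cV[R]_p) : A *m y = \sum_j y j 0 *: tnth (cols A) j.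
Proof.
apply/colP => i; rewrite !mxE summxE; apply: eq_bigr => j _.
by rewrite tnth_cols !mxE mulrC.
Qed.

Lemma span_cols A : <<cols A>>%VS = colspan A.
Proof.
apply/eqP; rewrite eqEsubv; apply/andP; split.
  apply/span_subvP => v /tnthP[j ->]; apply/memv_colspan; exists (delta_mx j 0).
  by rewrite tnth_cols colE.
apply/subvP => v /memv_colspan[y ->]; rewrite mulmx_cols.
by apply: memv_suml => j _; apply: memvZ; apply: memv_span; exact: mem_tnth.
Qed.

Lemma basis_cols A (U : {vspace 'cV[R]_n}) : \dim U = p -> U = colspan A ->
  basis_of U (cols A).
Proof. by move=> dU UA; rewrite basisEdim span_cols -UA subvv dU size_tuple leqnn. Qed.

Lemma colspan_tuple (t : p.-tuple 'cV[R]_n) :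
  colspan (\matrix_(i, j) tnth t j i 0) = <<t>>%VS.
Proof.
rewrite -span_cols; congr (<<_>>%VS); apply: (congr1 val).
by apply: eq_from_tnth => j; rewrite tnth_cols; apply/colP => i; rewrite !mxE.
Qed.

Lemma colspan_basis (U : Gr R p n) : exists A, grspace U = colspan A.
Proof.
exists (\matrix_(i, j) tnth (basis_tuple U) j i 0); rewrite colspan_tuple.
by rewrite (span_basis (basis_tupleP U)).
Qed.

Lemma colspan_factor q (A : 'M[R]_(n, q)) B :
  (forall y : 'cV[R]_q, A *m y \in colspan B) -> exists C, A = B *m C.
Proof.
move=> h; have /choice[c hc] : forall j, exists y : 'cV[R]_p, col j A = B *m y.
  by move=> j; apply/memv_colspan; rewrite colE.
exists (\matrix_(i, j) c j i 0); apply/matrixP => i j.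
have := hc j => /colP/(_ i); rewrite !mxE => ->.
by apply: eq_bigr => k _; rewrite !mxE.
Qed.

Lemma dim_colspan_inj A : (forall y : 'cV[R]_p, A *m y = 0 -> y = 0) ->
  \dim (colspan A) = p.
Proof.
move=> h; rewrite limg_dim_eq ?dimvf ?/dim /= ?muln1 //.
apply/eqP; rewrite -subv0; apply/subvP => y; rewrite memv_cap memv_ker memv0.
by rewrite lfunE /= => /andP[_ /eqP/h ->].
Qed.

Lemma dim_colspan A (B : 'M[R]_(p, n)) : B *m A \in unitmx -> \dim (colspan A) = p.
Proof.
move=> uBA; apply: dim_colspan_inj => y Ay.
by rewrite -(mulKmx uBA y) -mulmxA Ay !mulmx0.
Qed.

Lemma colspan_inj A (y : 'cV[R]_p) : \dim (colspan A) = p -> A *m y = 0 -> y = 0.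
Proof.
move=> dA Ay.
have : (lker (linfun (mulmx A : 'cV[R]_p -> 'cV[R]_n)) == 0)%VS.
  rewrite -dimv_eq0; have := limg_ker_dim (linfun (mulmx A : 'cV[R]_p -> 'cV[R]_n)) fullv.
  rewrite capfv -/(colspan A) dA dimvf /dim /= muln1 => /eqP.
  by rewrite -[X in _ == X]add0n eqn_add2r.
move/eqP => k0; apply/eqP; rewrite -memv0 -k0 memv_ker lfunE /= Ay //.
Qed.

Lemma colspan_mulr A (C : 'M[R]_p) : C \in unitmx -> colspan (A *m C) = colspan A.
Proof.
move=> uC; apply/vspaceP => v; apply/memv_colspan/memv_colspan => -[y ->].
  by exists (C *m y); rewrite mulmxA.
by exists (invmx C *m y); rewrite -mulmxA mulKVmx.
Qed.

Lemma gl_image_colspan (g : 'M[R]_n) A : gl_image g (colspan A) = colspan (g *m A).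
Proof.
apply/vspaceP => v; apply/memv_imgP/memv_colspan.
  by move=> [u /memv_colspan[y ->] ->]; exists y; rewrite lfunE /= mulmxA.
move=> [y ->]; exists (A *m y); first by apply/memv_colspan; exists y.
by rewrite lfunE /= mulmxA.
Qed.

Definition rowminor A (f : 'I_p -> 'I_n) : R := \det (\matrix_(i, j) A (f i) j).

Lemma minor_cols A f : minor (cols A) f = rowminor A f.
Proof. by congr (\det _); apply/matrixP => i j; rewrite !mxE tnth_cols mxE. Qed.

(** The Cauchy-Binet expansion before the terms are grouped by the image of the
row selection; this form needs no sorting. *)
Lemma det_mulmx_rowminor (B : 'M[R]_(p, n)) A :
  \det (B *m A) = \sum_(f : {ffun 'I_p -> 'I_n}) (\prod_i B i (f i)) * rowminor A f.
Proof.
rewrite /determinant.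
under eq_bigr => s _.
  under eq_bigr => i _ do rewrite mxE.
  rewrite bigA_distr_bigA /= big_distrr /=. over.
rewrite exchange_big; apply: eq_bigr => f _; rewrite /rowminor /determinant.
rewrite big_distrr /=; apply: eq_bigr => s _.
rewrite big_split /= mulrCA; congr (_ * (_ * _)).
by apply: eq_bigr => i _; rewrite !mxE.
Qed.

Lemma rowminor_linear (f : 'I_p -> 'I_n) : exists a : 'rV[R]_(wedge_dim p n),
  forall A, (a *m wedge (cols A)) 0 0 = rowminor A f.
Proof.
have [finj|nf] := pselect (injective f).
  have [g [s fgs]] := increasing_sort finj.
  exists ((-1) ^+ s *: delta_mx 0 (enum_rank g)) => A.
  rewrite -scalemxAl -rowE !mxE enum_rankK minor_cols /rowminor -det_perm -det_mulmx.
  rewrite -row_permE; congr (\det _); apply/matrixP => i j; rewrite !mxE.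
  by rewrite fgs.
exists 0 => A; rewrite mul0mx mxE; apply/esym.
have [i [j [fij ij]]] : exists i j, f i = f j /\ i != j.
  apply: contrapT => h; apply: nf => i j fij; apply/eqP/negPn/negP => ij.
  by apply: h; exists i, j.
by apply: (determinant_alternate ij) => k; rewrite !mxE fij.
Qed.

(** A determinant of [p] linear forms depends only on the exterior product of the
vectors, and linearly so.  This is how coordinates of the chart become functions on
the projective space. *)
Lemma det_wedge_linear (B : 'M[R]_(p, n)) : exists a : 'rV[R]_(wedge_dim p n),
  forall A, (a *m wedge (cols A)) 0 0 = \det (B *m A).
Proof.
have /choice[a ha] := rowminor_linear.
exists (\sum_(f : {ffun 'I_p -> 'I_n}) (\prod_i B i (f i)) *: a f) => A.
rewrite mulmx_suml summxE det_mulmx_rowminor; apply: eq_bigr => f _.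
by rewrite -scalemxAl mxE ha.
Qed.

Lemma wedge_cols_continuous : continuous (fun A => wedge (cols A)).
Proof.
apply: continuous_mx => k j.
have -> : (fun A => wedge (cols A) k j) =
    fun A => rowminor A (val (@enum_val _ {: wedge_index p n} k)).
  by apply/funext => A; rewrite mxE minor_cols.
move=> A; apply: (@cvg_det _ _ _ (nbhs A)).
move: A; apply: continuous_mx => i l.
by under eq_fun do rewrite mxE; exact: coord_continuous.
Qed.

End Colspan.

(** * Topology of the Grassmannian *)

Section GrTopology.
Variables (R : realType).

Lemma projspace_open N (V : set (projspace R N)) : open V ->
  exists2 V' : set 'cV[R]_N, open V' &
    forall v (v0 : v != 0), V (projpt v0) <-> V' v.
Proof.
move=> [V' oV' eV]; exists V' => // v v0.
have /seteqP[h1 h2] := eV.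
by split=> [Vv|V'v]; [exact: (h2 _ Vv)|exact: (h1 (exist _ v (mem_set v0)))].
Qed.

Lemma plucker_cols p n (U : Gr R p n) A : grspace U = colspan A ->
  exists v0 : wedge (cols A) != 0, plucker U = projpt v0.
Proof.
move=> UA; have b : basis_of (val (U : subspaces R p n)) (cols A).
  by apply: basis_cols => //; exact: dim_grspace.
by exists (wedge_basis_neq0 b); exact: plucker_basis.
Qed.

Lemma Gr_open p n (Om : set (Gr R p n)) : open Om ->
  exists2 V : set 'cV[R]_(wedge_dim p n), open V &
    forall (U : Gr R p n) A, grspace U = colspan A -> Om U <-> V (wedge (cols A)).
Proof.
move=> [W oW <-]; have [V oV hV] := projspace_open oW; exists V => // U A UA.
by have [v0 pU] := plucker_cols UA; rewrite -(hV _ v0) -pU.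
Qed.

Lemma repr_projpt N (v : 'cV[R]_N) (v0 : v != 0) :
  exists2 c : R, c != 0 & val (repr (projpt v0)) = c *: v.
Proof.
have : projpt v0 = \pi_(projspace R N) (repr (projpt v0)) by rewrite reprK.
by move=> /eqmodP /asboolP.
Qed.

Lemma mulmxZ00 N (d : 'rV[R]_N) (v : 'cV[R]_N) (c : R) :
  (d *m (c *: v)) 0 0 = c * (d *m v) 0 0.
Proof. by rewrite -scalemxAr mxE. Qed.

(** A quotient of two linear forms is homogeneous of degree zero, so the choice of
representative is immaterial ([proj_ratioE]). *)
Definition proj_ratio N (a b : 'rV[R]_N) (x : projspace R N) : R :=
  (a *m val (repr x)) 0 0 / (b *m val (repr x)) 0 0.

Lemma proj_ratioE N (a b : 'rV[R]_N) v (v0 : v != 0) :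
  proj_ratio a b (projpt v0) = (a *m v) 0 0 / (b *m v) 0 0.
Proof.
rewrite /proj_ratio; have [c c0 ->] := repr_projpt v0.
by rewrite !mulmxZ00 -mulf_div divff // mul1r.
Qed.

(** An open neighbourhood in the quotient is the image of a saturated open set of
representatives; the condition that the ratio be near its value at [x] defines
one, by homogeneity. *)
Lemma proj_ratio_continuous N (a b : 'rV[R]_N) (x : projspace R N) :
  (b *m val (repr x)) 0 0 != 0 -> {for x, continuous (proj_ratio a b)}.
Proof.
move=> bx W nW.
have ca (d : 'rV[R]_N) : continuous (fun v : 'cV[R]_N => (d *m v) 0 0).
  move=> v; apply: (cvg_comp (fun v : 'cV[R]_N => d *m v) (fun w : 'M[R]_1 => w 0 0)).
    exact: mulmxl_continuous.
  exact: coord_continuous.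
pose r (v : 'cV[R]_N) := (a *m v) 0 0 / (b *m v) 0 0.
pose D : set 'cV[R]_N := [set v | (b *m v) 0 0 != 0 /\ W° (r v)].
have oD : open D.
  rewrite openE => v [bv Wv]; rewrite /interior.
  have h1 : nbhs v [set v | (b *m v) 0 0 != 0].
    have nz : nbhs ((b *m v) 0 0) [set d : R | d != 0].
      by rewrite nbhsE; exists [set d | d != 0] => //; split=> //; exact: open_neq.
    exact: (ca b v _ nz).
  have cr : r @ v --> r v.
    have c1 := ca a v; have c2 := ca b v.
    exact: (cvgM c1 (cvgV bv c2)).
  have h2 : nbhs v (r @^-1` W°).
    have nW' : nbhs (r v) W° by apply: open_nbhs_nbhs; split=> //; exact: open_interior.
    exact: (cr _ nW').
  by apply: filterS2 h1 h2.
pose D' : set (projspace R N) := [set y | D (val (repr y))].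
have D'E v (v0 : v != 0) : D' (projpt v0) <-> D v.
  rewrite /D' /D /=; have [c c0 ->] := repr_projpt v0.
  have -> : r (c *: v) = r v.
    by rewrite /r !mulmxZ00 -mulf_div divff // mul1r.
  by rewrite mulmxZ00 mulf_eq0 negb_or c0.
rewrite nbhsE /=; exists D'.
  split; last by split=> //; exact: nbhs_singleton (nbhs_interior nW).
  exists D => //; apply/seteqP.
  have pE (w : nonzero R N) : projpt (set_mem (valP w)) = \pi_(projspace R N) w.
    by congr (\pi_(projspace R N) _); exact: val_inj.
  by split=> w /=; rewrite -pE D'E.
by move=> y [_ /interior_subset].
Qed.

End GrTopology.

(** * Rank-one directions and lines *)

Lemma unitmx_of_inj (F : fieldType) n (A : 'M[F]_n) :
  (forall y : 'cV[F]_n, A *m y = 0 -> y = 0) -> A \in unitmx.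
Proof.
move=> h; rewrite -unitmx_tr -row_free_unit -kermx_eq0; apply/eqP/row_matrixP => i.
rewrite row0; apply: trmx_inj; rewrite trmx0; apply: h; apply: trmx_inj.
by rewrite trmx_mul trmxK trmx0 -row_mul mulmx_ker row0.
Qed.

Section SetColumn.
Variables (R : realType) (p n : nat).
Implicit Types A : 'M[R]_(n, p).

Definition setcol A j (v : 'cV[R]_n) : 'M[R]_(n, p) :=
  \matrix_(i, k) if k == j then v i 0 else A i k.

(** Linearity in one column makes the pencil of matrices obtained by varying that
column a projective line. *)
Lemma wedge_setcol A j a b u v : wedge (cols (setcol A j (a *: u + b *: v))) =
  a *: wedge (cols (setcol A j u)) + b *: wedge (cols (setcol A j v)).
Proof.
apply/colP => k; rewrite !mxE !minor_cols /rowminor; set f := val _.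
rewrite -det_tr -[\det (\matrix_(_, _) setcol A j u _ _)]det_tr.
rewrite -[\det (\matrix_(_, _) setcol A j v _ _)]det_tr.
apply: (determinant_multilinear (i0 := j)).
- by apply/rowP => i; rewrite !mxE eqxx.
- by apply/matrixP => i l; rewrite !mxE eq_sym (negPf (neq_lift _ _)).
- by apply/matrixP => i l; rewrite !mxE eq_sym (negPf (neq_lift _ _)).
Qed.

Lemma setcol_add A j (m : 'cV[R]_n) t :
  setcol A j (col j A + t *: m) = A + t *: (m *m delta_mx 0 j).
Proof.
apply/matrixP => i k; rewrite !mxE big_ord1 !mxE eqxx /=.
by case: eqVneq => [->|]; rewrite ?mulr1 ?mulr0 ?addr0.
Qed.

Lemma setcolD A j (u m : 'cV[R]_n) b :
  setcol A j u + b *: (m *m delta_mx 0 j) = setcol A j (u + b *: m).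
Proof.
apply/matrixP => i k; rewrite !mxE big_ord1 !mxE eqxx /=.
by case: (k == j); rewrite ?mulr1 ?mulr0 ?addr0.
Qed.

(** By a column operation the row factor of a rank-one direction becomes a
coordinate vector, so that moving along the direction changes a single column. *)
Lemma row_to_delta (f : 'rV[R]_p) : f != 0 ->
  exists C j, C \in unitmx /\ f *m C = delta_mx 0 j.
Proof.
move=> /rV0Pn[j fj].
pose h : 'rV[R]_p := f - delta_mx 0 j.
(* [M] is the identity with row [j] replaced by [f]; its inverse [C] is given by
   the Sherman-Morrison formula. *)
pose C := 1%:M - (f 0 j)^-1 *: (delta_mx j 0 *m h).
pose M := 1%:M + delta_mx j 0 *m h.
have hd : h *m delta_mx j 0 = (f 0 j - 1)%:M.
  by apply/matrixP => i k; rewrite !ord1 -colE !mxE !eqxx mulr1n.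
have key (N : 'M[R]_p) (c : R) : c != 0 -> N *m N = (c - 1) *: N ->
    (1%:M + N) *m (1%:M - c^-1 *: N) = 1%:M.
  move=> c0 NN; rewrite mulmxDl mul1mx mulmxBr mulmx1 -scalemxAr NN.
  by apply/matrixP => a b; rewrite !mxE; field.
have MC : M *m C = 1%:M.
  apply: key => //; rewrite -mulmxA (mulmxA h) hd mul_scalar_mx -scalemxAr //.
exists C, j; split; first by have [_] := mulmx1_unit MC.
have fM : delta_mx 0 j *m M = f.
  rewrite /M mulmxDr mulmx1 mulmxA mul_delta_mx.
  have -> : delta_mx 0 0 = 1%:M :> 'M[R]_1.
    by apply/matrixP => a b; rewrite !ord1 !mxE.
  by rewrite mul1mx addrC subrK.
by rewrite -fM -mulmxA MC mulmx1.
Qed.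

End SetColumn.

Lemma mulmx_setcol (R : realType) (m n p : nat) (A : 'M[R]_(m, n)) (B : 'M[R]_(n, p)) j v :
  A *m setcol B j v = setcol (A *m B) j (A *m v).
Proof.
apply/matrixP => i k; rewrite !mxE.
by case E: (k == j); apply: eq_bigr => l _; rewrite mxE E.
Qed.

(** * The domain in matrix coordinates *)

Section Translate.
Variables (R : realType) (p : nat).
Variables (W0 : Gr R p (p + p)) (Om : set (Gr R p (p + p))).
Variable G : 'M[R]_(p + p).
Hypothesis uG : G \in unitmx.
Hypothesis GW : grspace W0 = colspan (G *m col_mx 0 1%:M).
Hypothesis Om_chart : Om `<=` chart W0.

Definition lift_set : set 'M[R]_(p + p, p) :=
  [set A | exists2 U, Om U & grspace U = colspan (G *m A)].

Lemma lift_set_mulr A C : lift_set A -> C \in unitmx -> lift_set (A *m C).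
Proof. by move=> [U OU UA] uC; exists U => //; rewrite mulmxA colspan_mulr. Qed.

(** The image of a vector killed by the upper half lies both in a point of [Om]
and in [W0]. *)
Lemma lift_set_unit A : lift_set A -> usubmx A \in unitmx.
Proof.
move=> [U OU UA]; apply: unitmx_of_inj => y uy.
have dA : \dim (colspan (G *m A)) = p by rewrite -UA dim_grspace.
have : G *m A *m y \in (grspace U :&: grspace W0)%VS.
  rewrite memv_cap UA GW; apply/andP; split; apply/memv_colspan; first by exists y.
  exists (dsubmx A *m y); rewrite -!mulmxA; congr (_ *m _).
  by rewrite -[in LHS](vsubmxK A) !mul_col_mx uy mul0mx mul1mx.
by rewrite (Om_chart OU) memv0 => /eqP; exact: colspan_inj.
Qed.

Lemma dim_colspan_lift (A : 'M[R]_(p + p, p)) : usubmx A \in unitmx ->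
  \dim (colspan (G *m A)) = p.
Proof.
move=> uA; apply: (@dim_colspan _ _ _ _ (usubmx (invmx G))).
by rewrite mul_usub_mx mulKmx.
Qed.

Lemma lift_set_open : open Om -> open lift_set.
Proof.
move=> /Gr_open[V oV hV]; rewrite openE => A OA; rewrite /interior.
have uA := lift_set_unit OA; have [U OU UA] := OA.
have c1 : nbhs A [set B | usubmx B \in unitmx].
  have cu : continuous (fun B : 'M[R]_(p + p, p) => usubmx B).
    apply: continuous_mx => i j; under eq_fun do rewrite mxE; exact: coord_continuous.
  exact: cu (unitmx_nbhs uA).
have c2 : nbhs A [set B | V (wedge (cols (G *m B)))].
  have cw : continuous (fun B : 'M[R]_(p + p, p) => wedge (cols (G *m B))).
    move=> B; apply: (cvg_comp (fun B : 'M[R]_(p + p, p) => G *m B)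
      (fun A => wedge (cols A))); first exact: mulmxl_continuous.
    exact: wedge_cols_continuous.
  by apply: cw; apply: open_nbhs_nbhs; split=> //; apply/(hV U).
apply: filterS2 c1 c2 => B uB VB.
exists (mkGr (dim_colspan_lift uB)) => //.
by apply/(hV _ (G *m B)).
Qed.

Lemma lift_coord (U : Gr R p (p + p)) : Om U ->
  exists X, grspace U = colspan (G *m chart_pt X).
Proof.
move=> OU; have [A UA] := colspan_basis U.
have OA : lift_set (invmx G *m A) by exists U => //; rewrite mulKVmx.
have uA := lift_set_unit OA.
exists (chart_coord (invmx G *m A)).
by rewrite -(colspan_mulr _ uA) -mulmxA chart_coordK // mulKVmx.
Qed.

Lemma lift_set_GL (phi : GL R (p + p)) : Aut Om (\pi_(PGL R (p + p)) phi) ->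
  forall A, lift_set A <-> lift_set (invmx G *m val phi *m G *m A).
Proof.
move=> aut A.
have e B : val phi *m (G *m B) = G *m (invmx G *m val phi *m G *m B).
  by rewrite !mulmxA mulmxV // mul1mx.
split=> [[U OU UA]|[U OU UA]].
  exists (gl_act phi U); last by rewrite /grspace /= -/(grspace U) UA gl_image_colspan e.
  by rewrite -aut -pi_pgl_act; exists U.
move: OU; rewrite -{1}aut => -[U' OU' e']; exists U' => //.
suff -> : colspan (G *m A) = colspan (invmx (val phi) *m (val phi *m (G *m A))).
  rewrite e -gl_image_colspan -UA -e' pi_pgl_act; have [B UB] := colspan_basis U'.
  rewrite /grspace /= -/(grspace U') UB !gl_image_colspan mulKmx //; exact: GLP.
by rewrite mulKmx // GLP.
Qed.

(** The coordinate [X i j] of a point of the chart is, by Cramer's rule, a quotient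
of two determinants of linear forms evaluated on any basis of the subspace.  Both are
linear in the Plucker vector, so the coordinate map is continuous and sends
compact sets to compact sets. *)
Lemma lift_coord_compact (K : set (Gr R p (p + p))) : compact K -> K `<=` Om ->
  compact [set X | exists2 U, K U & grspace U = colspan (G *m chart_pt X)].
Proof.
move=> cK KO.
pose B0 : 'M[R]_(p, p + p) := usubmx (invmx G).
pose B i j : 'M[R]_(p, p + p) :=
  \matrix_(k, l) if k == j then dsubmx (invmx G) i l else B0 k l.
have [a0 ha0] := det_wedge_linear B0.
have /choice[a ha] : forall ij : 'I_p * 'I_p, exists a : 'rV[R]_(wedge_dim p (p + p)),
    forall A, (a *m wedge (cols A)) 0 0 = \det (B ij.1 ij.2 *m A).
  by move=> ij; exact: det_wedge_linear.
pose c (U : Gr R p (p + p)) : 'M[R]_p :=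
  \matrix_(i, j) proj_ratio (a (i, j)) a0 (plucker U).
have GX X : invmx G *m (G *m chart_pt X) = chart_pt X by rewrite mulKmx.
have B0X X : B0 *m (G *m chart_pt X) = 1%:M by rewrite mul_usub_mx GX col_mxKu.
have BX i j X : \det (B i j *m (G *m chart_pt X)) = X i j.
  (* The identity matrix with row [j] replaced by row [i] of [X]. *)
  have -> : B i j *m (G *m chart_pt X) =
      \matrix_(k, l) if k == j then X i l else (1%:M : 'M[R]_p) k l.
    apply/row_matrixP => k; rewrite row_mul.
    have [->|kj] := eqVneq k j.
      have -> : row j (B i j) = row i (dsubmx (invmx G)).
        by apply/rowP => l; rewrite !mxE eqxx.
      rewrite -row_mul mul_dsub_mx GX col_mxKd.
      by apply/rowP => l; rewrite !mxE eqxx.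
    have -> : row k (B i j) = row k B0 by apply/rowP => l; rewrite !mxE (negPf kj).
    rewrite -row_mul B0X; apply/rowP => l; rewrite !mxE (negPf kj) //.
  rewrite (expand_det_row _ j).
  have adj1 : \adj (1%:M : 'M[R]_p) = 1%:M by rewrite -[LHS]mul1mx mul_mx_adj det1.
  under eq_bigr => l _.
    rewrite (_ : cofactor _ j l = (1%:M : 'M[R]_p) l j); last first.
      rewrite -[in RHS]adj1 mxE /cofactor; congr (_ * \det _).
      by apply/matrixP => k m; rewrite !mxE [lift j k == j]eq_sym (negPf (neq_lift _ _)).
    rewrite !mxE eqxx. over.
  rewrite (bigD1 j) //= eqxx mulr1 big1 ?addr0 // => l /negPf lj.
  by rewrite lj mulr0.
have cE (U : Gr R p (p + p)) X : grspace U = colspan (G *m chart_pt X) -> c U = X.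
  move=> UX; apply/matrixP => i j; rewrite mxE; have [v0 ->] := plucker_cols UX.
  by rewrite proj_ratioE ha ha0 /= B0X det1 divr1 BX.
rewrite (_ : [set X | _] = c @` K); last first.
  apply/seteqP; split=> [X [U KU UX]|_ [U KU <-]]; first by exists U => //; exact: cE.
  by have [X UX] := lift_coord (KO _ KU); exists U => //; rewrite (cE _ _ UX).
apply: continuous_compact => //; apply: continuous_in_subspaceT => U /set_mem KU.
apply: (@cvg_mx_entries _ _ _ _ (nbhs U)) => i j.
under eq_fun do rewrite mxE.
rewrite mxE.
apply: (cvg_comp (@plucker R p (p + p) : Gr R p (p + p) -> _) (proj_ratio (a (i, j)) a0)).
  exact: (@initial_continuous _ _ (@plucker R p (p + p)) U).
apply: proj_ratio_continuous.
have [X UX] := lift_coord (KO _ KU); have [v0 ->] := plucker_cols UX.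
have [r r0 ->] := repr_projpt v0.
by rewrite mulmxZ00 ha0 B0X det1 mulr1.
Qed.

(** After a column operation a rank-one line in the chart moves one column of the
representing matrix by multiples of a vector [m].  Together with the matrix in
which that column is replaced by [m], its points form the pencil [T], whose
Plucker vectors fill a projective line contained in the Grassmannian.  If
the whole affine line were in the domain, the projective line would have a single point
outside the image of [Om], against properness. *)
Lemma lift_no_rank1_line : (0 < p)%N -> Rproper Om ->
  no_rank1_line [set X | lift_set (chart_pt X)].
Proof.
move=> p0 rO X x f x0 f0 SX; apply: contrapT => nt.
have line t : lift_set (chart_pt (X + t *: (x *m f))).
  by apply: contrapT => h; apply: nt; exists t.
have [C [j [uC fC]]] := row_to_delta f0.
pose A := G *m chart_pt X *m C; pose m := G *m col_mx 0 x.
have lineA t : exists2 U, Om U & grspace U = colspan (A + t *: (m *m delta_mx 0 j)).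
  have [U OU UE] := line t; exists U => //; rewrite UE.
  rewrite -(colspan_mulr _ uC); congr colspan.
  have -> : chart_pt (X + t *: (x *m f)) = chart_pt X + t *: (col_mx 0 x *m f).
    by rewrite mul_col_mx mul0mx scale_col_mx scaler0 /chart_pt add_col_mx addr0.
  rewrite mulmxDr mulmxDl -scalemxAr -scalemxAl /A /m; congr (_ + _ *: _).
  by rewrite -fC !mulmxA.
pose T a b := setcol A j (a *: col j A + b *: m).
(* Every member of the pencil is a genuine [p]-dimensional subspace. *)
have Tinj (a b : R) : ((a != 0) || (b != 0)) ->
    forall y : 'cV[R]_p, T a b *m y = 0 -> y = 0.
  move=> ab y.
  pose D : 'M[R]_p := setcol 1%:M j (a *: delta_mx j 0).
  have -> : T a b = A *m D + b *: (m *m delta_mx 0 j).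
    by rewrite mulmx_setcol mulmx1 setcolD -scalemxAr -colE.
  have -> : A *m D + b *: (m *m delta_mx 0 j) =
      G *m (chart_pt X *m (C *m D) + col_mx 0 (b *: (x *m delta_mx 0 j))).
    rewrite mulmxDr /A /m -!mulmxA; congr (_ + _).
    by rewrite scalemxAr mul_col_mx mul0mx scale_col_mx scaler0.
  rewrite -mulmxA => /(congr1 (mulmx (invmx G))); rewrite mulKmx // mulmx0.
  rewrite mulmxDl !mul_col_mx !mul1mx mul0mx add_col_mx addr0 -(@col_mx0 _ p p).
  move=> /eq_col_mx[CD].
  have -> : X *m (C *m D) *m y = X *m (C *m D *m y) by rewrite !mulmxA.
  rewrite CD mulmx0 add0r => xy.
  have Dy : D *m y = 0 by rewrite -(mulKmx uC (D *m y)) (mulmxA C) CD mulmx0.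
  have DyE k : (D *m y) k 0 = (if k == j then a else 1) * y k 0.
    rewrite mxE (bigD1 k) //= !mxE big1 ?addr0.
      by case: eqVneq => // _; rewrite ?eqxx ?mulr1 // !mxE ?eqxx ?mulr1.
    move=> l lk; rewrite !mxE; case: eqVneq => [lj|_].
      by rewrite -lj eq_sym (negPf lk) mulr0 mul0r.
    by rewrite eq_sym (negPf lk) mul0r.
  have yk k : k != j -> y k 0 = 0.
    by move=> kj; have := DyE k; rewrite Dy mxE (negPf kj) mul1r.
  have ayj : a * y j 0 = 0 by have := DyE j; rewrite Dy mxE eqxx.
  have byj : b * y j 0 = 0.
    have /cV0Pn[i xi] := x0; move: xy; rewrite -scalemxAl -mulmxA.
    move=> /colP/(_ i); rewrite !mxE big_ord1 -rowE !mxE => /eqP.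
    by rewrite mulrCA mulf_eq0 (negPf xi) /= => /eqP.
  apply/colP => k; rewrite mxE; have [->|] := eqVneq k j; last exact: yk.
  move/eqP: ayj; move/eqP: byj; rewrite !mulf_eq0.
  by case/orP: ab => /negPf -> /=; [move=> _|]; move=> /eqP.
have Tgr (a b : R) : (a != 0) || (b != 0) ->
    exists U : Gr R p (p + p), exists v0 : wedge (cols (T a b)) != 0,
    grspace U = colspan (T a b) /\ plucker U = projpt v0.
  move=> ab; have dT := dim_colspan_inj (Tinj _ _ ab).
  have [v0 pU] := @plucker_cols _ _ _ (mkGr dT) (T a b) erefl.
  by exists (mkGr dT), v0.
pose w0 := wedge (cols (setcol A j (col j A))).
pose w1 := wedge (cols (setcol A j m)).
have wT a b : wedge (cols (T a b)) = a *: w0 + b *: w1 by exact: wedge_setcol.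
have wfree : free [:: w0; w1].
  have wn0 (a b : R) : (a != 0) || (b != 0) -> a *: w0 + b *: w1 != 0.
    by move=> ab; have [_ [v0 _]] := Tgr _ _ ab; rewrite -wT.
  rewrite free_cons seq1_free span_seq1; apply/andP; split.
    apply/vlineP => -[k w0k]; have := wn0 1 (- k); rewrite oner_neq0 => /(_ isT).
    by rewrite scale1r w0k scaleNr subrr eqxx.
  by have := wn0 0 1; rewrite oner_neq0 orbT scale0r add0r scale1r; apply.
have wspan v : v \in <<[:: w0; w1]>>%VS -> exists a b, v = a *: w0 + b *: w1.
  rewrite span_cons span_seq1 => /memv_addP[u /vlineP[a ->] [z /vlineP[b ->] ->]].
  by exists a, b.
pose l := proj_subspace <<[:: w0; w1]>>%VS.
have lE y : l y -> exists a b, ((a != 0) || (b != 0)) /\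
    exists v0 : (a *: w0 + b *: w1 != 0), y = projpt v0.
  move=> [v [v0 [/wspan[a [b vE]] ->]]]; exists a, b; split.
    apply: contraNT v0; rewrite negb_or !negbK => /andP[/eqP a0 /eqP b0].
    by rewrite vE a0 b0 !scale0r addr0.
  rewrite vE in v0 *; by exists v0.
have gl : gr_line l.
  split; first by exists <<[:: w0; w1]>>%VS => //; have /eqP := wfree.
  move=> y /lE[a [b [ab [v0 ->]]]].
  have [U [v1 [_ UE]]] := Tgr _ _ ab; exists U => //; rewrite UE.
  by apply/projpt_eq; exists 1; rewrite ?oner_neq0 // scale1r wT.
have [y [z [/eqP yz ly lz]]] := rO l gl; apply: yz.
(* Members with [a != 0] are on the affine line, so a point of the projective line
   outside [Om] has [a = 0]: there is only one. *)
have key q : (l `\` plucker @` Om) q ->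
    exists b, exists v0 : (b *: w1 != 0), b != 0 /\ q = projpt v0.
  move=> [/lE[a [b [ab [v0 qE]]]] nq].
  have [a0|a0] := eqVneq a 0.
    rewrite a0 eqxx /= in ab; rewrite a0 scale0r add0r in v0 qE; by exists b, v0.
  exfalso; apply: nq; have [U OU UE] := lineA (a^-1 * b).
  have UT : grspace U = colspan (T 1 (a^-1 * b)) by rewrite UE /T scale1r setcol_add.
  have [v1 pU] := plucker_cols UT.
  exists U => //; rewrite pU qE; apply/projpt_eq; exists a => //.
  by rewrite wT scale1r scalerDr scalerA mulrA mulfV // mul1r.
have [b [v0 [b0 ->]]] := key _ ly; have [d [v1 [d0 ->]]] := key _ lz.
apply/projpt_eq; exists (d / b); first by rewrite mulf_neq0 // invr_neq0.
by rewrite scalerA divfK.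
Qed.

End Translate.

(** * From the matrix model to the automorphism group *)

Section Frames.
Variables (R : realType) (p : nat).

Lemma chart_frame (W0 U0 : Gr R p (p + p)) : chart W0 U0 ->
  exists G : 'M[R]_(p + p), [/\ G \in unitmx,
    grspace U0 = colspan (G *m col_mx 1%:M 0) &
    grspace W0 = colspan (G *m col_mx 0 1%:M)].
Proof.
move=> UW; have [A UA] := colspan_basis U0; have [B WB] := colspan_basis W0.
exists (row_mx A B); rewrite !mul_row_col !mulmx1 !mulmx0 addr0 add0r; split=> //.
apply: unitmx_of_inj => y; rewrite -[y](vsubmxK y) mul_row_col => e.
have : A *m usubmx y \in (grspace U0 :&: grspace W0)%VS.
  rewrite memv_cap UA WB; apply/andP; split; apply/memv_colspan.
    by exists (usubmx y).
  by exists (- dsubmx y); rewrite mulmxN; apply/eqP; rewrite -addr_eq0 e.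
rewrite UW memv0 => /eqP Ay.
have dA : \dim (colspan A) = p by rewrite -UA dim_grspace.
have dB : \dim (colspan B) = p by rewrite -WB dim_grspace.
rewrite Ay add0r in e.
by rewrite (colspan_inj dA Ay) (colspan_inj dB e) col_mx0.
Qed.

(** [X] represents the linear map [T X] from [U0] to [W0] whose matrix in the frame
is [X], and [X |-> T X] is affine. *)
Lemma lift_convex (W0 U0 : Gr R p (p + p)) (Om : set (Gr R p (p + p)))
    (G : 'M[R]_(p + p)) : G \in unitmx ->
  grspace U0 = colspan (G *m col_mx 1%:M 0) ->
  grspace W0 = colspan (G *m col_mx 0 1%:M) ->
  convex_set [set T : 'Hom(subvs_of (grspace U0), subvs_of (grspace W0)) |
    exists2 U, Om U & grspace U = graph T] ->
  mxconvex [set X | lift_set Om G (chart_pt X)].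
Proof.
move=> uG GU GW cvx.
(* Coordinates on [U0] in the frame, then [X], then back into [W0]. *)
pose Q X : 'M[R]_(p + p) := G *m col_mx 0 1%:M *m X *m usubmx (invmx G).
pose T X : 'Hom(subvs_of (grspace U0), subvs_of (grspace W0)) :=
  (linfun (vsproj (grspace W0)) \o
   linfun (mulmx (Q X) : 'cV[R]_(p + p) -> 'cV[R]_(p + p)) \o linfun vsval)%VF.
have TE X u : vsval (T X u) = Q X *m vsval u.
  rewrite !comp_lfunE !lfunE /= vsprojK // GW; apply/memv_colspan.
  by exists (X *m usubmx (invmx G) *m vsval u); rewrite /Q !mulmxA.
have QE X y : Q X *m (G *m col_mx 1%:M 0 *m y) = G *m col_mx 0 1%:M *m X *m y :> 'cV_ _.
  rewrite /Q -!mulmxA; do 3 congr (_ *m _).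
  by rewrite !mulmxA mul_usub_mx mulVmx // mul_usub_mx mul1mx col_mxKu mul1mx.
have graphT X : graph (T X) = colspan (G *m chart_pt X).
  have ptE y : G *m chart_pt X *m y =
      G *m col_mx 1%:M 0 *m y + G *m col_mx 0 1%:M *m X *m y :> 'cV_ _.
    rewrite -!mulmxA -mulmxDr; congr (_ *m _).
    by rewrite !mul_col_mx !mul1mx !mul0mx add_col_mx addr0 add0r.
  apply/vspaceP => v; apply/idP/idP.
    move=> /memv_graph[u ->]; rewrite TE; apply/memv_colspan.
    have /memv_colspan[y uy] : vsval u \in colspan (G *m col_mx 1%:M 0).
      by rewrite -GU; exact: subvsP.
    by exists y; rewrite uy QE ptE.
  move=> /memv_colspan[y ->]; apply/memv_graph.
  have yU : G *m col_mx 1%:M 0 *m y \in grspace U0.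
    by rewrite GU; apply/memv_colspan; exists y.
  by exists (Subvs yU); rewrite TE /= QE ptE.
move=> X Y l l0 l1 [U OU UX] [V OV VY].
pose D := [set F : 'Hom(subvs_of (grspace U0), subvs_of (grspace W0)) |
  exists2 U, Om U & grspace U = graph F].
have DX : D (T X) by exists U => //; rewrite graphT.
have DY : D (T Y) by exists V => //; rewrite graphT.
have := cvx _ _ (Itv01 (ltW l0) (ltW l1)) (mem_set DY) (mem_set DX).
rewrite inE => -[Z OZ ZE]; exists Z => //; rewrite -graphT ZE; congr (graph _).
rewrite -[LHS]/(l *: T Y + (1 - l) *: T X).
apply/lfunP => u; apply: val_inj; rewrite -[RHS]/(vsval _) TE.
rewrite add_lfunE !scale_lfunE -[LHS]/(vsval _) linearD !linearZ /=.
rewrite !TE /Q mulmxDr !mulmxDl -scalemxAr -!scalemxAl mulmxBr !mulmxBl.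
by rewrite scalerBl scale1r scalerBr addrCA.
Qed.

(** Were the class of [phi 0] isolated in [A], all [phi u] with [u] small would be
scalar matrices. *)
Lemma one_parameter_nondiscrete n (A : set (PGL R n)) (phi : R -> GL R n) :
  continuous (fun u => val (phi u)) -> val (phi 0) = 1%:M ->
  (forall u, A (\pi_(PGL R n) (phi u))) ->
  (forall u c, val (phi u) = c *: 1%:M -> u = 0) ->
  ~ discrete_subset A.
Proof.
move=> cphi phi0 Aphi inj dA.
have [_ [V nV VA]] := dA _ (Aphi 0).
have cp : continuous phi by apply: continuous_comp_initial.
have c0 := cp 0.
have c1 := @pi_continuous _ {eq_quot @proportional R 'M[R]_n (GL R n)} (phi 0).
have h : nbhs (0 : R) [set u | V (\pi_(PGL R n) (phi u))] := c0 _ (c1 _ nV).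
have /nbhs_ballP[e /= e0 he] := h.
have Vu : V (\pi_(PGL R n) (phi (e / 2))).
  by apply: he; rewrite -ball_normE /= sub0r normrN gtr0_norm; lra.
have : (V `&` A) (\pi_(PGL R n) (phi (e / 2))) by split=> //; exact: Aphi.
rewrite VA => /esym/pgl_eq[c _]; rewrite phi0 => /inj.
lra.
Qed.

Lemma Aut_lift (Om : set (Gr R p (p + p))) (G : 'M[R]_(p + p)) (phi : GL R (p + p)) :
  G \in unitmx ->
  (forall A, lift_set Om G A <-> lift_set Om G (invmx G *m val phi *m G *m A)) ->
  Aut Om (\pi_(PGL R (p + p)) phi).
Proof.
move=> uG h; have uphi := GLP phi.
have actE (U : Gr R p (p + p)) (A : 'M[R]_(p + p, p)) : grspace U = colspan A ->
    grspace (gl_act phi U) = colspan (val phi *m A).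
  by move=> UA; rewrite /grspace /= -/(grspace U) UA gl_image_colspan.
apply/seteqP; split=> [_ [U OU <-]|U OU].
  have [A UA] := colspan_basis U; rewrite pi_pgl_act.
  have /h[V OV VA] : lift_set Om G (invmx G *m A) by exists U => //; rewrite mulKVmx.
  suff -> : gl_act phi U = V by [].
  apply: grspace_inj; rewrite (actE _ _ UA) VA.
  by rewrite -!mulmxA !(mulKVmx uG).
have [A UA] := colspan_basis U.
have [V OV VA] : lift_set Om G (invmx G *m (invmx (val phi) *m A)).
  by apply/h; exists U => //; rewrite UA -!mulmxA !(mulKVmx uG) mulKVmx.
exists V => //; rewrite pi_pgl_act; apply: grspace_inj.
by rewrite (actE _ _ VA) UA (mulKVmx uG) mulKVmx.
Qed.

End Frames.

(** The dimension is a variable equal to [p + p] because block matrices need that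
form on the nose. *)
Lemma Aut_nondiscrete (R : realType) (p n : nat) : n = (p + p)%N -> (0 < p)%N ->
  forall (W0 : Gr R p n) (Om : set (Gr R p n)),
  Om `<=` chart W0 -> Om !=set0 -> open Om -> chart_convex W0 Om ->
  Rproper Om -> cocompact Om -> ~ discrete_subset (Aut Om).
Proof.
move=> -> p0 W0 Om OW [U1 OU1] oO [U0 WU0 cvx] rO [K [cK KO KOm]].
have [G [uG GU GW]] := chart_frame WU0.
pose S := [set X | lift_set Om G (chart_pt X)].
have cS : mxconvex S := lift_convex uG GU GW cvx.
have nS : no_rank1_line S := lift_no_rank1_line uG p0 rO.
have S0 : S !=set0.
  by have [X UX] := lift_coord uG GW OW OU1; exists X, U1.
have oL : open (lift_set Om G) := lift_set_open uG GW OW oO.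
pose KX := [set X | exists2 U, K U & grspace U = colspan (G *m chart_pt X)].
have cKX : compact KX := lift_coord_compact uG GW OW cK KO.
have KS : KX `<=` S by move=> X [U KU UX]; exists U => //; exact: KO.
have LU := @lift_set_unit _ _ _ _ _ GW OW.
have orb Y : S Y -> exists (h : 'M[R]_(p + p)) X C,
    [/\ h \in unitmx, KX X, h *m chart_pt X = chart_pt Y *m C &
      forall A, lift_set Om G A <-> lift_set Om G (h *m A)].
  move=> [U OU UY].
  have [x Ax [V KV xV]] : [set pgl_act x U | x in Aut Om & U in K] U by rewrite KOm.
  have [X VX] := lift_coord uG GW OW (KO _ KV).
  elim/quotW: x Ax xV => phi Aphi xV.
  have UV : grspace U = colspan (val phi *m (G *m chart_pt X)).
    by rewrite -xV pi_pgl_act /grspace /= -/(grspace V) VX gl_image_colspan.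
  have [C hC] : exists C : 'M[R]_p, val phi *m (G *m chart_pt X) = G *m chart_pt Y *m C.
    apply: colspan_factor => y; rewrite -UY UV; apply/memv_colspan; by exists y.
  exists (invmx G *m val phi *m G), X, C; split.
  - by rewrite !unitmx_mul unitmx_inv uG GLP.
  - by exists V.
  - by rewrite -!mulmxA hC -mulmxA mulKmx.
  - exact: (lift_set_GL uG Aphi).
have [xi [g [ug hg]]] :=
  cone_symmetry p0 oL (@lift_set_mulr _ _ Om G) LU S0 cS nS cKX KS orb.
have dilU u : dil xi (expR u) \in unitmx.
  suff /mulmx1_unit[] : dil xi (expR u) *m dil xi (expR u)^-1 = 1%:M by [].
  by rewrite dilM mulfV ?dil1 // gt_eqF // expR_gt0.
pose L := G *m invmx g; pose L' := g *m invmx G.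
have LL' : L *m L' = 1%:M by rewrite /L /L' mulmxA mulmxKV // mulmxV.
have uL : L \in unitmx by rewrite unitmx_mul uG unitmx_inv.
have uL' : L' \in unitmx by rewrite unitmx_mul ug unitmx_inv.
have uphi u : L *m dil xi (expR u) *m L' \in unitmx.
  by rewrite unitmx_mul uL' andbT unitmx_mul uL dilU.
apply: (@one_parameter_nondiscrete _ _ _ (fun u => mkGL (uphi u))) => /=.
- have dilE s : dil xi s = block_mx 1%:M 0 xi 0 + s *: block_mx 0 0 (- xi) 1%:M.
    rewrite /dil scale_block_mx add_block_mx !scaler0 !addr0 add0r scalemx1.
    by rewrite scalerBl scale1r scalerN.
  have cd : continuous (fun u : R => dil xi (expR u)).
    under eq_fun do rewrite dilE.
    move=> u; apply: (@cvgD _ _ _ (nbhs u)); first exact: cvg_cst.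
    by apply: cvgZr_tmp; exact: continuous_expR.
  move=> u; apply: (cvg_comp (fun u => L *m dil xi (expR u)) (fun D => D *m L')).
    apply: (cvg_comp (fun u => dil xi (expR u)) (fun D => L *m D)); first exact: cd.
    exact: mulmxl_continuous.
  exact: mulmx_continuous.
- by rewrite expR0 dil1 mulmx1.
- move=> u; apply: (@Aut_lift _ _ _ G) => // A /=.
  rewrite (hg _ (expR_gt0 u)) /L /L' !mulmxA mulVmx // mul1mx.
  by rewrite -(mulmxA _ (invmx G) G) mulVmx // mulmx1.
move=> u c e.
have conj_scalar (M M' D : 'M[R]_(p + p)) : M' *m M = 1%:M ->
    M *m D *m M' = c *: 1%:M -> D = c%:M.
  move=> MM e'; have : M' *m (M *m D *m M') *m M = c%:M.
    by rewrite e' scalemx1 mul_mx_scalar -scalemxAl MM scalemx1.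
  by rewrite !mulmxA MM mul1mx -mulmxA MM mulmx1.
have dE : dil xi (expR u) = c%:M := conj_scalar _ _ _ (mulmx1C LL') e.
(* The upper left block of a dilation is the identity and the lower right one is
   [expR u], so a scalar dilation has [expR u = 1]. *)
pose i0 := Ordinal p0.
have := congr1 (fun D => ulsubmx D i0 i0) dE; rewrite block_mxKul !mxE eqxx mulr1n.
have := congr1 (fun D => drsubmx D i0 i0) dE; rewrite block_mxKdr !mxE !eqxx mulr1n.
by move=> eu c1; apply: expR_inj; rewrite expR0 eu c1.
Qed.

Theorem corollary1p12 (R : realType) (p : nat) (p_gt0 : (0 < p)%N)
    (W0 : Gr R p (2 * p)%N) (Om : set (Gr R p (2 * p)%N))
    (Om_chart : Om `<=` chart W0) (Om_neq0 : Om !=set0)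
    (Om_open : open Om) (Om_convex : chart_convex W0 Om)
    (Om_proper : Rproper Om) (Om_cocompact : cocompact Om) :
  ~ discrete_subset (Aut Om).
Proof.
apply: (@Aut_nondiscrete R p (2 * p)%N _ p_gt0 W0) => //.
by rewrite mul2n addnn.
Qed.
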